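(* For all $n\ge 2$ and all $\mathbf{m}=(m_1,\dots,m_n)$ with $m_i\ge 2$, writing $q_{n,\mathbf{m}} := \frac{\prod_{i=1}^n m_i}{\max_i m_i}$, $$\frac{1}{4\sqrt{n}}\frac{1}{\sqrt{q_{n,\mathbf{m}}}}\le \Pr\left[\text{the clockwork best-response dynamic on } G_{n,\mathbf{m}} \text{ converges to a PNE}\right]\le \frac{6n\sqrt{\log(q_{n,\mathbf{m}})}}{\sqrt{q_{n,\mathbf{m}}}}.$$
   Context: A random game $G_{n,\mathbf{m}}$ has $n\ge 2$ players; player $i$ has action set $[m_i]=\{1,\dots,m_i\}$ with $m_i\ge 2$; $\mathcal{M}=\times_{i=1}^n[m_i]$. For each player $i$ and profile $\mathbf{a}\in\mathcal{M}$ the payoff $U_i(\mathbf{a})$ is drawn from a fixed atomless probability distribution on $\mathbb{R}$, independently across all $i$ and $\mathbf{a}$. The best response $B_i(\mathbf{a}_{-i})=\arg\max_{x\in[m_i]}U_i(x,\mathbf{a}_{-i})$ is almost surely unique. A pure Nash equilibrium (PNE) is a profile $\mathbf{a}$ with $a_i=B_i(\mathbf{a}_{-i})$ for all $i$. The clockwork playing sequence is $s_{\texttt{c}}(t)=1+((t-1)\bmod n)$, $t\in\{1,2,\dots\}$. The clockwork best-response dynamic: draw $\mathbf{A}^0$ uniformly from $\mathcal{M}$ (independently of payoffs); for each $t\ge1$, with $i=s_{\texttt{c}}(t)$, set $A^t_j=A^{t-1}_j$ for $j\ne i$ and $A^t_i=B_i(\mathbf{A}^{t-1}_{-i})$. The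 dynamic converges to a PNE if there is a finite $t\ge 1$ such that $\mathbf{A}^t$ is a PNE. $\log$ is the natural logarithm. *)

(* Defs.v *)
From HB Require Import structures.
From mathcomp Require Import all_boot all_order all_algebra.
From mathcomp Require Import all_classical all_reals all_analysis.
Set Implicit Arguments. Unset Strict Implicit. Unset Printing Implicit Defensive.
Import Order.TTheory GRing.Theory Num.Theory.
Local Open Scope ring_scope.

(* Action profiles: player i (0-indexed, i : 'I_n) plays an action in
   'I_(m i) = {0,...,m i - 1} (a relabelling of [m_i] = {1,...,m_i}). *)
Definition profile (n : nat) (m : 'I_n -> nat) : finType :=
  {dffun forall i : 'I_n, 'I_(m i)}.

Definition deviate n (m : 'I_n -> nat) (a : profile m) (i : 'I_n)
  (x : 'I_(m i)) : profile m :=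
  @finfun 'I_n (fun k => 'I_(m k))
    (fun j => @dfwith _ (fun k => 'I_(m k)) (fun k => a k) i x j).

(* Best response B_i(a_{-i}) = argmax_x U_i(x, a_{-i}); ties (a null event)
   are broken towards the first maximiser in the enumeration of 'I_(m i),
   so the value depends only on a_{-i} (a i is only a dummy default). *)
Definition best_resp (R : realType) n (m : 'I_n -> nat)
  (U : 'I_n -> profile m -> R) (a : profile m) (i : 'I_n) : 'I_(m i) :=
  Order.arg_max (a i) xpredT (fun x : 'I_(m i) => U i (deviate a x)).

Definition is_PNE (R : realType) n (m : 'I_n -> nat)
  (U : 'I_n -> profile m -> R) (a : profile m) : Prop :=
  forall i : 'I_n, a i = best_resp U a i.

(* Clockwork best-response dynamic: A^0 = a0 and, at step t >= 1, the
   player s_c(t) = 1 + ((t-1) mod n) (0-indexed: (t-1) %% n) best responds. *)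
Fixpoint clockwork (R : realType) n (m : 'I_n -> nat)
  (U : 'I_n -> profile m -> R) (a0 : profile m) (t : nat) : profile m :=
  match t with
  | 0 => a0
  | t'.+1 =>
      let a := clockwork U a0 t' in
      @finfun 'I_n (fun k => 'I_(m k))
        (fun j => if nat_of_ord j == (t' %% n)%N then best_resp U a j else a j)
  end.

Definition clockwork_converges (R : realType) n (m : 'I_n -> nat)
  (U : 'I_n -> profile m -> R) (a0 : profile m) : Prop :=
  exists t : nat, (1 <= t)%N /\ is_PNE U (clockwork U a0 t).

Definition qnm (R : realType) n (m : 'I_n -> nat) : R :=
  ((\prod_(i < n) m i)%N)%:R / ((\max_(i < n) m i)%N)%:R.

(* Main.v *)
Require Import Defs.
From HB Require Import structures.
From mathcomp Require Import all_boot all_order all_algebra.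
From mathcomp Require Import all_classical all_reals all_analysis.
From mathcomp Require Import perm zify ring lra.
Set Implicit Arguments. Unset Strict Implicit. Unset Printing Implicit Defensive.
Import Order.TTheory GRing.Theory Num.Theory.

(** Almost surely the best responses to distinct (player, opponents' actions)
    queries are independent and uniform, so, as long as no query is repeated,
    the dynamic unfolds like a sequence of independent uniform actions.  A
    repeated query makes the path periodic; the dynamic reaches an equilibrium
    exactly when the first repetition occurs one round after the original, that
    is when all other players kept their actions for a whole round.

    Let i be a player with most actions, so that q counts the action profiles
    of the other players.  In the unfolded sequence the successive queries of i
    are independent and uniform on a set of size q.  Hence, by the birthday
    bound, N + 1 rounds without repetition have probability at most
    exp (- N (N + 1) / (2 q)), and each of the first N n opportunities for an
    equilibrium has probability at most 1 / q; N ~ sqrt (q log q) gives the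
    upper bound.  For the lower bound, player i repeats the query of the
    previous round with probability 1 / q in each of the first N ~ sqrt (q / n)
    rounds, and by a union bound no other repetition interferes with
    probability at least about 1 / 2 on average over these rounds.

    That the answer to a fresh query is uniform is obtained by exchanging two
    payoffs of its block: the joint law of the payoffs is invariant under this
    transposition, and earlier answers are not affected by it. *)

(** * Repetitions along a path *)

Section Collision.
Variable n : nat.
Implicit Types (xi : nat -> nat) (t s : nat).

(* A play is encoded as a sequence xi of actions: xi 0, ..., xi (n - 1) is the
   initial profile and xi (t + n) is the action chosen at the move of time t
   (moves are counted from 0).  The profile before that move consists of
   xi t, ..., xi (t + n - 1), where xi t belongs to the player about to move, so
   coll xi t t' says that the queries at times t and t' coincide. *)
Definition coll xi t t' : bool :=
  [&& t' < t, t == t' %[mod n] &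
      [forall u : 'I_n, (0 < u) ==> (xi (t + u) == xi (t' + u))]].

Definition fresh xi t : bool :=
  [forall s : 'I_t, forall s' : 'I_s, ~~ coll xi s s'].

Definition deterministic xi :=
  forall t t', coll xi t t' -> xi (t + n) = xi (t' + n).

Lemma collP xi t t' :
  reflect [/\ t' < t, t = t' %[mod n] &
              forall u, 0 < u < n -> xi (t + u) = xi (t' + u)]
          (coll xi t t').
Proof.
apply: (iffP and3P) => -[lt_t eq_t H]; split => //.
- exact/eqP.
- move=> u /andP[u0 un].
  by move/forallP/(_ (Ordinal un)): H; rewrite /= u0 => /eqP.
- exact/eqP.
- by apply/forallP => u; apply/implyP => u0; rewrite H ?u0 /=.
Qed.

Lemma freshP xi t :
  reflect (forall s s', s < t -> ~~ coll xi s s') (fresh xi t).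
Proof.
apply: (iffP forallP) => [H s s' st|H s].
  have [s's|] := ltnP s' s; last by move=> ?; apply/negP => /collP[]; lia.
  by move/forallP: (H (Ordinal st)) => /(_ (Ordinal s's)).
by apply/forallP => s'; apply: H.
Qed.

Lemma eq_coll xi xi' t t' :
  (forall s, s < t + n -> xi s = xi' s) -> coll xi t t' = coll xi' t t'.
Proof.
move=> E; apply/collP/collP => -[lt_t eq_t H]; split => // u un.
  by rewrite -!E ?H //; lia.
by rewrite !E ?H //; lia.
Qed.

Lemma eq_fresh xi xi' t :
  (forall s, s.+1 < t + n -> xi s = xi' s) -> fresh xi t = fresh xi' t.
Proof.
move=> E; apply/freshP/freshP => H s s' st.
  by rewrite -(@eq_coll xi) ?H // => r ?; apply: E; lia.
by rewrite (@eq_coll xi xi') ?H // => r ?; apply: E; lia.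
Qed.

(** Equal queries receive equal answers, so the action that enters the next query agrees as well and
    the repetition moves on by one time step. *)
Lemma coll_shift xi t t' k :
  deterministic xi -> coll xi t t' -> coll xi (t + k) (t' + k).
Proof.
move=> D C; elim: k => [|k IH]; first by rewrite !addn0.
have E := D _ _ IH; case/collP: IH => lt_t eq_t H.
apply/collP; split; first by lia.
  by rewrite -(addn1 k) !addnA; apply/eqP; rewrite eqn_modDr; apply/eqP.
move=> u un; have [->|ne] := eqVneq u n.-1.
  have -> : t + k.+1 + n.-1 = t + k + n by lia.
  by rewrite E; congr xi; lia.
have -> : t + k.+1 + u = t + k + u.+1 by lia.
by rewrite H; [congr xi; lia|lia].
Qed.

Lemma coll_periodic xi t t' u : 1 < n ->
  deterministic xi -> coll xi t t' -> 0 < u -> xi (t + u) = xi (t' + u).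
Proof.
move=> n1 D C u0; have /collP[_ _ H] := coll_shift u.-1 D C.
have := H 1; rewrite n1 => /(_ isT).
by rewrite -!addnA addn1 prednK.
Qed.

(* A first repetition with a gap larger than n starts a cycle along which all
   queries are distinct, so the path is never eventually n-periodic. *)
Lemma first_coll_gap xi t t' T : 1 < n ->
  deterministic xi -> fresh xi t -> coll xi t t' ->
  (forall s, T <= s -> coll xi (s + n) s) -> t = t' + n.
Proof.
move=> n1 D F C ev.
have /collP[lt_t eq_t _] := C.
have [c Ec] : exists c, t = t' + c.+1 * n.
  have : n %| t - t' by rewrite -eqn_mod_dvd ?(ltnW lt_t) //; apply/eqP.
  by case/dvdnP => -[|c] E; [lia|exists c; lia].
case: c Ec => [|c] Ec; first by lia.
(* From [t' + 1] on the path has period [t - t']. *)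
have per k u : 0 < u -> xi (t' + k * (t - t') + u) = xi (t' + u).
  move=> u0; elim: k => [|k IH]; first by rewrite mul0n addn0.
  have u0' : 0 < k * (t - t') + u by rewrite addn_gt0 u0 orbT.
  have := coll_periodic n1 D C u0'; rewrite -IH addnA addnA => <-.
  by congr xi; rewrite mulSn addnA subnKC // ltnW.
(* A gap of two rounds or more puts [t' + n] before [t], where freshness forbids a repetition; the
   eventual [n]-periodicity, carried back by [T] periods, forces one. *)
have nc : ~~ coll xi (t' + n) t' by apply: (freshP _ _ F); nia.
case/negP: nc; apply/collP; split; [lia|by rewrite modnDr|move=> u un].
have /collP[_ _ /(_ u un)] := ev (t' + T * (t - t')) ltac:(nia).
rewrite per; last by lia.
by rewrite -(addnA _ n u) per -?addnA //; lia.
Qed.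

End Collision.

(** * Turn order and windows of [n] consecutive moves *)

Section Turns.
Variable n : nat.
Hypothesis n_gt0 : 0 < n.

Definition pl s : 'I_n := Ordinal (ltn_pmod s n_gt0).

(* The unique time in the window [t, t + n) at which player j moves. *)
Definition pos t (j : 'I_n) := t + (j + n * t - t) %% n.

Lemma pos_window t j : t <= pos t j < t + n.
Proof. by rewrite /pos leq_addr ltn_add2l ltn_pmod. Qed.

Lemma pl_pos t j : pl (pos t j) = j.
Proof.
apply/val_inj; rewrite /= /pos modnDmr.
have -> : t + (j + n * t - t) = t * n + j.
  rewrite subnKC ?(mulnC t) 1?addnC //; apply: leq_trans (leq_addr _ _).
  by rewrite leq_pmull.
by rewrite modnMDl modn_small.
Qed.

Lemma modn_window s s' t :
  s = s' %[mod n] -> t <= s < t + n -> t <= s' < t + n -> s = s'.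
Proof.
wlog le : s s' / s <= s' => [W E H H'|].
  by have [le|le] := leqP s s'; [exact: W|apply/esym/W => //; exact: ltnW].
move=> /esym/eqP; rewrite eqn_mod_dvd // => d H H'; have : s' - s < n by lia.
have [?|p] := posnP (s' - s); first by lia.
by have := dvdn_leq p d; lia.
Qed.

Lemma pl_eq s s' : (pl s == pl s') = (s == s' %[mod n]).
Proof. by rewrite -val_eqE. Qed.

Lemma pos_pl s t : t <= s < t + n -> pos t (pl s) = s.
Proof.
move=> H; apply: (@modn_window _ _ t) => //; last exact: pos_window.
by have /eqP := pl_pos t (pl s); rewrite pl_eq => /eqP.
Qed.

Lemma plDn s : pl (s + n) = pl s.
Proof. by apply/eqP; rewrite pl_eq modnDr. Qed.

Lemma plDM s k : pl (s + k * n) = pl s.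
Proof. by apply/eqP; rewrite pl_eq addnC modnMDl. Qed.

Lemma pl_ord (j : 'I_n) : pl j = j.
Proof. by apply/val_inj; rewrite /= modn_small. Qed.

Lemma pl_window t s : t < s < t + n -> pl s != pl t.
Proof.
move=> H; apply/eqP => /eqP; rewrite pl_eq => /eqP E.
by have := @modn_window _ _ t E; lia.
Qed.

End Turns.

(** * Cardinalities of finite products and unions *)

Lemma card_dffun_zero_on (I : finType) (D : I -> nat) (C : pred I) :
  (forall i, 0 < D i) ->
  #|[set x : {dffun forall i, 'I_(D i)} | [forall i, C i ==> (x i == 0 :> nat)]]|
    = \prod_(i | ~~ C i) D i.
Proof.
move=> D_gt0.
pose A i : {set 'I_(D i)} := [set y : 'I_(D i) | C i ==> (y == 0 :> nat)].
have -> : [set x : {dffun forall i, 'I_(D i)} | [forall i, C i ==> (x i == 0 :> nat)]]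
    = setXn A.
  by apply/setP => x; rewrite inE in_setXn; apply: eq_forallb => i; rewrite inE.
rewrite cardsXn [RHS]big_mkcond /=; apply: eq_bigr => i _; rewrite /A.
case: (C i) => /=; last by rewrite -[RHS]card_ord cardsE; apply: eq_card.
rewrite -(cards1 (Ordinal (D_gt0 i))); apply: eq_card => y.
by rewrite !inE -val_eqE.
Qed.

Lemma card_dffun_ord (I : finType) (D : I -> nat) : (forall i, 0 < D i) ->
  #|{dffun forall i, 'I_(D i)}| = \prod_i D i.
Proof.
move=> D_gt0; rewrite -(card_dffun_zero_on xpred0) // cardsE.
by apply: eq_card => x; rewrite !inE; apply/esym/forallP.
Qed.

Lemma leq_card_bigcup (I T : finType) (F : I -> {set T}) :
  #|\bigcup_i F i| <= \sum_i #|F i|.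
Proof.
elim/big_ind2: _ => [|a A b B Aa Bb|//]; first by rewrite cards0.
by apply: leq_trans (leq_card_setU A B).1 _; apply: leq_add.
Qed.

Lemma leq_sum_nat a b (F G : nat -> nat) :
  (forall s, a <= s < b -> F s <= G s) ->
  \sum_(a <= s < b) F s <= \sum_(a <= s < b) G s.
Proof.
move=> H; rewrite big_nat_cond [leqRHS]big_nat_cond.
by apply: leq_sum => s /andP[/H].
Qed.

(** * Counting sequences of moves *)

Section Counting.
Variables (n : nat) (m : 'I_n -> nat).
Hypotheses (n_gt0 : 0 < n) (m_gt0 : forall i, 0 < m i).
Local Notation pl := (pl n_gt0).
Implicit Types (C : pred nat) (g : nat -> nat).

Definition moves l : finType := {dffun forall s : 'I_l, 'I_(m (pl s))}.

(** Padding with 0, a legal action of every player, lets finite sequences be read as infinite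
    paths. *)
Definition ext l (x : moves l) s : nat :=
  if insub s is Some i then nat_of_ord (x i) else 0.

Definition clip j v : 'I_(m j) := insubd (Ordinal (m_gt0 j)) v.

Lemma clipE j v : v < m j -> clip j v = v :> nat.
Proof. by move=> vj; rewrite /clip val_insubd vj. Qed.

(** The number of distinct queries that player [j] can face; for a player with most actions it is
    q. *)
Definition others j := \prod_(i | i != j) m i.

Lemma others_gt0 j : 0 < others j.
Proof. by apply: prodn_cond_gt0. Qed.

Lemma extE l (x : moves l) (s : 'I_l) : ext x s = x s.
Proof. by rewrite /ext valK. Qed.

Lemma ext_valid l (x : moves l) s : ext x s < m (pl s).
Proof.
rewrite /ext; case: insubP => [i _ <-|_]; last exact: m_gt0.
exact: ltn_ord.
Qed.

Lemma eq_ext l (x y : moves l) :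
  (forall s, s < l -> ext x s = ext y s) -> x = y.
Proof.
move=> E; apply/ffunP => s; apply/val_inj.
by have := E _ (ltn_ord s); rewrite !extE.
Qed.

Lemma card_moves l : #|moves l| = \prod_(s < l) m (pl s).
Proof. exact: card_dffun_ord. Qed.

(* Erasing the coordinates in C is the counting device below: a sequence whose
   coordinates in C are copied from earlier ones can be recovered from it. *)
Definition zero_on (C : pred nat) l (x : moves l) : moves l :=
  finfun (fun s : 'I_l => if C s then clip (pl s) 0 else x s).

Lemma ext_zero_on C l (x : moves l) s :
  ext (zero_on C x) s = if C s then 0 else ext x s.
Proof.
rewrite /ext; case: insubP => [i _ <-|_]; last by case: ifP.
by rewrite ffunE; case: ifP => // _; rewrite clipE.
Qed.

Definition zeros (C : pred nat) l :=
  [set x : moves l | [forall s : 'I_l, C s ==> (x s == 0 :> nat)]].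

Lemma zero_on_zeros C l (x : moves l) : zero_on C x \in zeros C l.
Proof.
rewrite inE; apply/forallP => s; apply/implyP => Cs.
by rewrite -extE ext_zero_on Cs.
Qed.

Lemma card_zeros C l : #|zeros C l| = \prod_(s < l | ~~ C s) m (pl s).
Proof. by rewrite card_dffun_zero_on. Qed.

Lemma card_moves_split C l :
  #|moves l| = #|zeros C l| * \prod_(s < l | C s) m (pl s).
Proof. by rewrite card_moves card_zeros (bigID (fun s : 'I_l => C s)) mulnC. Qed.

Definition linked (C : pred nat) (g : nat -> nat) l :=
  [set x : moves l | [forall s : 'I_l, C s ==> (ext x s == ext x (g s))]].

Lemma linkedP C g l (x : moves l) :
  reflect (forall s, s < l -> C s -> ext x s = ext x (g s)) (x \in linked C g l).
Proof.
rewrite inE; apply: (iffP forallP) => [H s sl Cs|H s].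
  by apply/eqP; have := H (Ordinal sl); rewrite Cs.
by apply/implyP => Cs; rewrite -H.
Qed.

(** Sources lie strictly earlier, so the coordinates in [C] can be recomputed from left to right and
    erasing them is injective. *)
Lemma card_linked_le C g l :
  (forall s, s < l -> C s -> g s < s) ->
  #|linked C g l| * \prod_(s < l | C s) m (pl s) <= #|moves l|.
Proof.
move=> gC; rewrite (card_moves_split C) leq_mul2r; apply/orP; right.
have inj : {in linked C g l &, injective (@zero_on C l)}.
  move=> x y /linkedP Hx /linkedP Hy E; apply: eq_ext.
  elim/ltn_ind => s IH sl; have [Cs|nCs] := boolP (C s).
    have gs := gC _ sl Cs; rewrite (Hx _ sl Cs) (Hy _ sl Cs).
    by apply: IH => //; apply: ltn_trans gs sl.
  by have := congr1 (fun z => ext z s) E; rewrite !ext_zero_on (negbTE nCs).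
rewrite -(card_in_imset inj); apply/subset_leq_card/fintype.subsetP => _ /imsetP[x _ ->].
exact: zero_on_zeros.
Qed.

(** As no source lies in [C], overwriting [C] from the sources gives a linked sequence, which
    together with the overwritten values determines the original. *)
Lemma card_linked_ge C g l :
  (forall s, s < l -> C s -> ~~ C (g s) /\ pl (g s) = pl s) ->
  #|moves l| <= #|linked C g l| * \prod_(s < l | C s) m (pl s).
Proof.
move=> gC.
pose f (x : moves l) : moves l :=
  finfun (fun s : 'I_l => if C s then clip (pl s) (ext x (g s)) else x s).
have extf x s : s < l -> ext (f x) s = if C s then ext x (g s) else ext x s.
  move=> sl; rewrite -[s]/(nat_of_ord (Ordinal sl)) !extE ffunE.
  case: ifP => // Cs; rewrite clipE //.
  by have [_ <-] := gC _ sl Cs; apply: ext_valid.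
have fn x s : ~~ C s -> ext (f x) s = ext x s.
  move=> nC; have [sl|ls] := ltnP s l; first by rewrite extf // (negbTE nC).
  by rewrite /ext insubF // ltnNge ls.
have -> : \prod_(s < l | C s) m (pl s) = #|zeros (predC C) l|.
  by rewrite card_zeros; apply: eq_bigl => s; rewrite /= negbK.
pose h (x : moves l) := (f x, zero_on (predC C) x).
have inj : injective h.
  move=> x y [E1 E2]; apply: eq_ext => s sl; have [Cs|nCs] := boolP (C s).
    have := congr1 (fun z => ext z s) E2.
    by rewrite !ext_zero_on /= Cs.
  by rewrite -fn // E1 fn.
rewrite -cardsX -cardsT -(card_imset _ inj).
apply/subset_leq_card/fintype.subsetP => _ /imsetP[x _ ->].
rewrite finset.in_setX zero_on_zeros andbT; apply/linkedP => s sl Cs.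
by have [nC _] := gC _ sl Cs; rewrite extf // Cs fn.
Qed.

Lemma prod_window l a s : a + n <= l -> a <= s < a + n ->
  \prod_(p < l | (a <= p < a + n) && (p != s :> nat)) m (pl p) = others (pl s).
Proof.
move=> al sa.
have posl (j : 'I_n) : pos a j < l.
  by have /andP[_ H] := pos_window n_gt0 a j; apply: leq_trans H al.
rewrite (reindex_onto (fun j => Ordinal (posl j)) (fun p : 'I_l => pl p)) /=.
  apply: eq_big => [j|j _]; last by rewrite pl_pos.
  rewrite (pos_window n_gt0) pl_pos eqxx andbT /=; congr negb.
  by apply/eqP/eqP => [<-|->]; rewrite ?pl_pos ?pos_pl.
by move=> p /andP[pa _]; apply/val_inj; rewrite /= pos_pl.
Qed.

(** The windows share at most the time [b], which the second one omits, so no factor is counted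
    twice. *)
Lemma prod_window2 l a b s :
  a + n <= b.+1 -> b + n <= l -> a <= s < a + n ->
  \prod_(p < l | (a <= p < a + n) && (p != s :> nat)
              || (b <= p < b + n) && (p != b :> nat)) m (pl p)
    = others (pl s) * others (pl b).
Proof.
move=> ab bl sa.
rewrite (bigID (fun p : 'I_l => (a <= p < a + n) && (p != s :> nat))) /=.
congr (_ * _).
  rewrite -(@prod_window l a s) //; last by lia.
  by apply: eq_bigl => p; lia.
rewrite -(@prod_window l b b) //; last by lia.
by apply: eq_bigl => p; lia.
Qed.

(** A repetition copies [n - 1] entries of the window from [t - t'] steps before, at the cost of one
    factor per opponent. *)
Lemma card_coll_le l t t' : t + n <= l -> t' < t ->
  #|[set x : moves l | coll n (ext x) t t']| * others (pl t) <= #|moves l|.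
Proof.
move=> tl t't; rewrite -(@prod_window l t t) //; last by lia.
apply: leq_trans (@card_linked_le
  (fun p => (t <= p < t + n) && (p != t)) (fun p => p - (t - t')) l _); last first.
  by move=> s sl /= ?; lia.
rewrite leq_mul2r; apply/orP; right; apply/subset_leq_card/fintype.subsetP => x.
rewrite inE => /collP[_ _ H]; apply/linkedP => s sl /andP[st ne].
have := H (s - t); rewrite subnKC; last by lia.
by move=> ->; [congr ext; lia|lia].
Qed.

(** For a gap of exactly one round the sources lie in the preceding window and are unconstrained, so
    the bound of [card_coll_le] is attained. *)
Lemma card_hit_ge t :
  #|moves (t + n + n)| <=
    #|[set x : moves (t + n + n) | coll n (ext x) (t + n) t]| * others (pl t).
Proof.
rewrite -(plDn n_gt0) -(@prod_window (t + n + n) (t + n) (t + n)) //; last by lia.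
set C := fun p => (t + n <= p < t + n + n) && (p != t + n).
apply: leq_trans (@card_linked_ge C (fun p => p - n) _ _) _.
  move=> s sl; rewrite /C => ?; split; first by lia.
  by rewrite -(plDn n_gt0 (s - n)) subnK //; lia.
rewrite leq_mul2r; apply/orP; right; apply/subset_leq_card/fintype.subsetP => x.
move=> /linkedP H; rewrite inE; apply/collP; split; [lia|by rewrite modnDr|].
by move=> u un; rewrite H; [congr ext; lia|lia|rewrite /C; lia].
Qed.

(** The costs of the two repetitions multiply once both are expressed as copying into disjoint sets
    of coordinates. In the second case the gap of two rounds keeps all sources earlier than their
    copies. *)
Lemma card_hit_coll_le l t s s' : t + n + n <= l -> s' < s ->
  (s <= t) || (t < s < t + n) && (s' + n + n <= s) ->
  #|[set x : moves l | coll n (ext x) (t + n) t && coll n (ext x) s s']|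
    * (others (pl s) * others (pl t)) <= #|moves l|.
Proof.
move=> tl s's; have [st _|ts /= H] := leqP s t.
  rewrite -(plDn n_gt0 t) -(@prod_window2 l s (t + n) s); try by lia.
  pose C p := (s <= p < s + n) && (p != s)
    || (t + n <= p < t + n + n) && (p != t + n).
  apply: leq_trans (@card_linked_le C
    (fun p => if p < s + n then p - (s - s') else p - n) l _); last first.
    by move=> p pl; rewrite /C; case: ltnP; lia.
  rewrite leq_mul2r; apply/orP; right; apply/subset_leq_card/fintype.subsetP => x.
  rewrite inE => /andP[/collP[_ _ H1] /collP[_ _ H2]].
  apply/linkedP => p pl; rewrite /C => Cp; case: ltnP => ps.
    have := H2 (p - s); rewrite subnKC; last by lia.
    by move=> ->; [congr ext; lia|lia].
  have := H1 (p - (t + n)); rewrite subnKC; last by lia.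
  by move=> ->; [congr ext; lia|lia].
(* The two windows overlap; copying the part after t + n back by one round, the
   second repetition becomes a condition on the window [t + 1, t + n]. *)
rewrite -(plDn n_gt0 t) -(@prod_window2 l t.+1 (t + n) s); try by lia.
pose C p := (t < p < t.+1 + n) && (p != s)
  || (t + n <= p < t + n + n) && (p != t + n).
apply: leq_trans (@card_linked_le C (fun p => if t + n < p then p - n else
  if s < p then p - (s - s') else p + n - (s - s')) l _); last first.
  move=> p pl; rewrite /C; case: (ltnP (t + n) p) => ?; first by lia.
  by case: (ltnP s p) => ?; lia.
rewrite leq_mul2r; apply/orP; right; apply/subset_leq_card/fintype.subsetP => x.
rewrite inE => /andP[/collP[_ _ H1] /collP[_ _ H2]].
apply/linkedP => p pl; rewrite /C => Cp.
have hit r : t + n < r < t + n + n -> ext x r = ext x (r - n).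
  move=> rt; have := H1 (r - (t + n)); rewrite subnKC; last by lia.
  by move=> ->; [congr ext; lia|lia].
case: ltnP => pt; first by apply: hit; lia.
case: ltnP => ps.
  have := H2 (p - s); rewrite subnKC; last by lia.
  by move=> ->; [congr ext; lia|lia].
have := H2 (p + n - s); rewrite subnKC; last by lia.
rewrite hit; last by lia.
by rewrite addnK => ->; [congr ext; lia|lia].
Qed.

Lemma prod_windows (i : 'I_n) K :
  \prod_(p < K * n + i | (i <= p) && (pl p != i)) m (pl p) = others i ^ K.
Proof.
pose P p := (i <= p) && (pl p != i).
rewrite -(big_mkord P (fun p => m (pl p))).
elim: K => [|K IH]; first by rewrite big_nat_cond big_pred0 // => p; rewrite /P; lia.
set a := K * n + i; have -> : K.+1 * n + i = a + n by rewrite /a; lia.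
rewrite (big_cat_nat (n := a)) ?leq_addr //= IH expnSr; congr (_ * _).
have pa : pl a = i by rewrite /a addnC plDM pl_ord.
rewrite (@big_nat_widenl _ _ _ a 0) // big_mkord.
rewrite -[in RHS]pa -(@prod_window (a + n) a a) //; last by lia.
apply: eq_bigl => p; rewrite /P -[in pl p != i]pa; have := ltn_ord p.
have ia : i <= a by apply: leq_addl.
have [->|ne] := eqVneq (nat_of_ord p) a; first by rewrite eqxx !andbF.
have [pa'|] := leqP a p; last by rewrite andbF.
by move=> pl; rewrite pl_window; lia.
Qed.

(** The query of player [i] in round [k]; its own coordinate is set to 0 so that equal windows mean
    equal queries. *)
Definition window (i : 'I_n) l (x : moves l) k : profile m :=
  finfun (fun j => clip j (if j == i then 0 else ext x (pos (k * n + i) j))).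

Lemma windowE i l (x : moves l) k u : 0 < u < n ->
  window i x k (pl (k * n + i + u)) = ext x (k * n + i + u) :> nat.
Proof.
move=> un; rewrite ffunE; case: eqP => [E|_].
  have := @pl_window n n_gt0 (k * n + i) (k * n + i + u) ltac:(lia).
  by rewrite E (addnC (k * n)) plDM pl_ord eqxx.
by rewrite clipE pos_pl ?ext_valid //; lia.
Qed.

(** The [N + 1] queries of [i] along a fresh sequence are distinct, so they form an injection into a
    set of size [others i], whence the falling factorial; the remaining coordinates are free. *)
Lemma birthday (i : 'I_n) N :
  #|[set x : moves (N * n + i + n) | fresh n (ext x) (N * n + i).+1]|
    * others i ^ N.+1 <= others i ^_ N.+1 * #|moves (N * n + i + n)|.
Proof.
have -> : N * n + i + n = N.+1 * n + i by lia.
set l := N.+1 * n + i; set F := [set x | _].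
pose C p := (i <= p) && (pl p != i).
rewrite (card_moves_split C) (prod_windows i N.+1) mulnA leq_mul2r; apply/orP; right.
pose E : {set profile m} := [set a : profile m | [forall j, (j == i) ==> (a j == 0 :> nat)]].
have cE : #|E| = others i by rewrite card_dffun_zero_on.
pose w (x : moves l) : {ffun 'I_N.+1 -> profile m} := [ffun k : 'I_N.+1 => window i x k].
pose I := [set f : {ffun 'I_N.+1 -> profile m} in ffun_on (mem E) | injectiveb f].
have cI : #|I| = others i ^_ N.+1.
  by rewrite card_inj_ffuns_on card_ord -cE.
pose h x := (w x, zero_on C x).
have inj : injective h.
  move=> x y [E1 E2]; apply: eq_ext => p pl.
  have [|nC] := boolP (C p); last first.
    by have := congr1 (fun z => ext z p) E2; rewrite !ext_zero_on (negbTE nC).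
  case/andP => ip ne.
  (* A coordinate in [C] has a nonzero offset [u] in its round [k], hence can be read off window
     [k]. *)
  set k := (p - i) %/ n; set u := (p - i) %% n.
  have Ep : p = k * n + i + u.
    by rewrite addnAC -divn_eq subnK.
  have kN : k < N.+1.
    by rewrite ltn_divLR //; rewrite /l in pl; lia.
  have un : 0 < u < n.
    rewrite ltn_pmod // andbT lt0n; apply: contra ne => /eqP u0.
    by rewrite Ep u0 addn0 addnC plDM pl_ord.
  rewrite Ep -!(windowE i _ _ un).
  suff -> : window i x k = window i y k by [].
  have := congr1 (fun f : {ffun 'I_N.+1 -> profile m} => f (Ordinal kN)) E1.
  by rewrite !ffunE.
rewrite -cI -cardsX -(card_imset _ inj).
apply/subset_leq_card/fintype.subsetP => _ /imsetP[x Fx ->].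
rewrite finset.in_setX zero_on_zeros andbT inE; apply/andP; split.
  apply/ffun_onP => k; rewrite ffunE inE; apply/forallP => j; apply/implyP => /eqP ->.
  by rewrite ffunE eqxx clipE.
apply/injectiveP.
suff H (k k' : 'I_N.+1) : k' < k -> w x k <> w x k'.
  move=> k k' E'; apply/val_inj; apply/eqP; case: ltngtP => // kk.
    by case: (H _ _ kk).
  by case: (H _ _ kk).
move=> kk; rewrite !ffunE => Ew.
move: Fx; rewrite inE => /freshP/(_ (k * n + i) (k' * n + i)).
have := ltn_ord k => kN; rewrite (_ : _ < _); last by nia.
move=> /(_ isT)/negP; apply; apply/collP; split; [nia|by rewrite !modnMDl|].
move=> u un; rewrite -!windowE //.
suff -> : pl (k * n + i + u) = pl (k' * n + i + u) by rewrite Ew.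
by apply/eqP; rewrite pl_eq -!addnA !modnMDl.
Qed.

(* Repetitions before time t + n that would disturb a repetition of the query
   of time t at time t + n.  Within the last round, a repetition after exactly
   one round is harmless: it is implied by the latter one. *)
Definition bad xi t : bool :=
  [exists s : 'I_(t + n), exists s' : 'I_s,
     coll n xi s s' && ((s <= t) || (s' + n + n <= s))].

Lemma badP xi t : reflect (exists s s', [/\ s < t + n, coll n xi s s' &
  (s <= t) || (s' + n + n <= s)]) (bad xi t).
Proof.
apply: (iffP existsP) => [[s /existsP[s' /andP[C H]]]|[s [s' [st C H]]]].
  by exists s, s'.
exists (Ordinal st); have /collP[s's _ _] := C.
by apply/existsP; exists (Ordinal s's); rewrite /= C.
Qed.

Definition hits t : {set moves (t + n + n)} :=
  [set x : moves (t + n + n) | coll n (ext x) (t + n) t].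

Definition good_hits t := [set x in hits t | ~~ bad (ext x) t].

(** A repetition that is not bad occurs after [t] with a gap of one round, and there the hit itself
    forces equal answers. *)
Lemma good_hits_consistent t x s s' : x \in good_hits t -> s < t + n ->
  coll n (ext x) s s' -> ext x (s + n) = ext x (s' + n).
Proof.
rewrite !inE => /andP[/collP[_ _ H] /badP nb] st C; have /collP[s's E _] := C.
have [st'|] := leqP s t; first by case: nb; exists s, s'; rewrite st'.
have [ss'|] := leqP (s' + n + n) s; first by case: nb; exists s, s'; rewrite ss' orbT.
move=> ss' ts.
have Es : s = s' + n.
  apply: (@modn_window n n_gt0 _ _ (s' + n)); rewrite ?modnDr //; last by lia.
  rewrite ss' andbT -(subnKC (ltnW s's)) leq_add2l dvdn_leq ?subn_gt0 //.
  by rewrite -eqn_mod_dvd ?(ltnW s's) //; apply/eqP.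
have := H (s - t); have -> : t + n + (s - t) = s + n by lia.
by move=> ->; [congr ext; lia|lia].
Qed.

(** The least gap, in rounds, at which a repetition at [s] is bad; gaps range up to [s %/ n], whence
    [bad_count]. *)
Definition bad_gap t s := if s <= t then 1 else 2.
Definition bad_count t s := (s %/ n).+1 - bad_gap t s.

(** A union bound cleared of denominators: hits have proportion at least 1/q, and hits with a given
    bad repetition at most 1/q^2. *)
Lemma card_good_hits t (q := others (pl t)) : (forall j, q <= others j) ->
  q * #|moves (t + n + n)| <=
    q ^ 2 * #|good_hits t| + (\sum_(s < t + n) bad_count t s) * #|moves (t + n + n)|.
Proof.
move=> qle; set X := #|moves _|.
pose B (s : 'I_(t + n)) (c : 'I_(bad_count t s)) : {set moves (t + n + n)} :=
  [set x : moves (t + n + n) |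
    coll n (ext x) (t + n) t && coll n (ext x) s (s - (c + bad_gap t s) * n)].
have cB s c : q ^ 2 * #|B s c| <= X.
  have cn : (c + bad_gap t s) * n <= s.
    rewrite -leq_divRL //; have := ltn_ord c; rewrite /bad_count; lia.
  apply: leq_trans (@card_hit_coll_le (t + n + n) t s (s - (c + bad_gap t s) * n) _ _ _).
  - by rewrite mulnC leq_mul2l -mulnn leq_mul ?orbT.
  - by [].
  - have : 0 < (c + bad_gap t s) * n by rewrite muln_gt0 n_gt0 /bad_gap; case: ifP; lia.
    by lia.
  - move: cn; rewrite /bad_gap; case: leqP => //= ts cn; rewrite ltn_ord /=.
    by rewrite mulnDl in cn *; lia.
have sub : hits t \subset good_hits t :|: \bigcup_s \bigcup_c B s c.
  apply/fintype.subsetP => x xh; rewrite inE; case: (boolP (bad (ext x) t)); last first.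
    by move=> nb; rewrite inE xh nb.
  move=> /badP[s [s' [st C H]]]; apply/orP; right.
  have /collP[s's E _] := C.
  have /dvdnP[k Ek] : n %| s - s' by rewrite -eqn_mod_dvd ?(ltnW s's) //; apply/eqP.
  have kb : bad_gap t s <= k.
    rewrite /bad_gap; move: H; case: leqP => /= _ H.
      by case: k Ek => //; lia.
    by case: k Ek => [|[|k]] //; lia.
  have ks : k <= s %/ n by rewrite leq_divRL //; lia.
  apply/bigcupP; exists (Ordinal st) => //; apply/bigcupP.
  have kc : k - bad_gap t s < bad_count t s by rewrite /bad_count; lia.
  exists (Ordinal kc) => //; rewrite inE /= subnK //.
  have -> : s - k * n = s' by lia.
  by rewrite C andbT; rewrite inE in xh.
have hitX : X <= #|hits t| * q by exact: card_hit_ge.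
apply: (@leq_trans (q ^ 2 * #|hits t|)); first by rewrite -mulnn -mulnA leq_mul2l mulnC hitX orbT.
have : #|hits t| <= #|good_hits t| + \sum_(s < t + n) \sum_c #|B s c|.
  apply: leq_trans (subset_leq_card sub) _; apply: leq_trans (leq_card_setU _ _).1 _.
  rewrite leq_add2l; apply: leq_trans (leq_card_bigcup _) _.
  by apply: leq_sum => s _; apply: leq_card_bigcup.
rewrite -(leq_pmul2l (m := q ^ 2)) ?expn_gt0 ?others_gt0 // => /leq_trans; apply.
rewrite mulnDr leq_add2l big_distrr big_distrl /=; apply: leq_sum => s _.
rewrite big_distrr /=; apply: (@leq_trans (\sum_(c < bad_count t s) X)).
  by apply: leq_sum => c _; apply: cB.
by rewrite sum_nat_const card_ord.
Qed.

Lemma sum_divn_lt K : (\sum_(0 <= s < K * n) s %/ n).*2 = n * (K * K.-1).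
Proof.
elim: K => [|K IH]; first by rewrite mul0n big_geq // muln0.
rewrite (big_cat_nat (n := K * n)) //=; last by rewrite leq_mul2r leqnSn orbT.
rewrite doubleD IH (@eq_big_nat _ _ _ _ _ _ (fun=> K)); last first.
  move=> s /andP[s1 s2]; apply/eqP; rewrite eqn_leq -ltnS ltn_divLR // leq_divRL //.
  by rewrite s1 s2.
rewrite sum_nat_const_nat mulSn addnK /=.
by case: K {IH} => [|K] /=; rewrite -?mul2n; nia.
Qed.

(** Times up to [t] contribute [s %/ n] each, and the [n - 1] later ones at most [k] each. *)
Lemma sum_bad_count (i : 'I_n) k :
  (\sum_(s < k * n + i + n) bad_count (k * n + i) s).*2 <= n * (k * (k + 3)).
Proof.
set t := k * n + i; rewrite -(big_mkord xpredT (bad_count t)).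
have ti : t.+1 <= k.+1 * n by rewrite /t; have := ltn_ord i; lia.
rewrite (big_cat_nat (n := t.+1)) //=; last by lia.
rewrite doubleD.
have H1 : (\sum_(0 <= s < t.+1) bad_count t s).*2 <= n * (k.+1 * k).
  rewrite -(sum_divn_lt k.+1) leq_double.
  rewrite (big_cat_nat (n := t.+1) (leq0n _) ti) /=; apply: leq_trans (leq_addr _ _).
  apply: leq_sum_nat => s st; rewrite /bad_count /bad_gap ifT ?subn1 //; lia.
have H2 : \sum_(t.+1 <= s < t + n) bad_count t s <= n * k.
  apply: (@leq_trans (\sum_(t.+1 <= s < t + n) k)); last first.
    by rewrite sum_nat_const_nat leq_mul2r; lia.
  apply: leq_sum_nat => s st; rewrite /bad_count /bad_gap ifF; last by lia.
  have : s %/ n < k.+2 by rewrite ltn_divLR //; have := ltn_ord i; rewrite /t in st; lia.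
  by lia.
by nia.
Qed.

End Counting.

(** * The dynamic as a path *)

Section BestResponse.
Variables (R : realType) (n : nat) (m : 'I_n -> nat).
Implicit Types (U : 'I_n -> profile m -> R) (a : profile m) (i : 'I_n).

Lemma deviate_same a i (x : 'I_(m i)) : deviate a x i = x.
Proof. by rewrite ffunE dfwithin. Qed.

Lemma deviate_other a i (x : 'I_(m i)) j : j != i -> deviate a x j = a j.
Proof. by move=> ji; rewrite ffunE dfwithout // eq_sym. Qed.

Lemma deviate_inj a i : injective (@deviate n m a i).
Proof. by move=> x y E; rewrite -(deviate_same a x) E deviate_same. Qed.

Lemma best_resp_max U a i (x : 'I_(m i)) :
  (U i (deviate a x) <= U i (deviate a (best_resp U a i)))%R.
Proof. by rewrite /best_resp; case: arg_maxP => // y _; apply. Qed.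

(** Only the order of the payoffs in the block matters: a maximiser exists, so the dummy default is
    never returned. *)
Lemma eq_best_resp U U' a a' i :
  (forall x y : 'I_(m i), (U i (deviate a x) <= U i (deviate a y))%R
                        = (U' i (deviate a' x) <= U' i (deviate a' y))%R) ->
  best_resp U a i = best_resp U' a' i.
Proof.
move=> E; rewrite /best_resp /Order.arg_max /extremum.
set p := (X in odflt (a i) (pick X)); set p' := (X in odflt (a' i) (pick X)).
have pp' : p =1 p'.
  by move=> x; rewrite /p /p' /=; apply: eq_forallb => y; rewrite /= E.
rewrite (eq_pick pp'); case: pickP => // none.
have := none (best_resp U' a' i); rewrite /p' /=.
by move/forallP; case=> y; apply: best_resp_max.
Qed.

Lemma best_resp_env U a a' i :
  (forall j, j != i -> a j = a' j) -> best_resp U a i = best_resp U a' i.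
Proof.
move=> E; apply: eq_best_resp => x y.
suff D (z : 'I_(m i)) : deviate a z = deviate a' z by rewrite !D.
apply/ffunP => j; have [->|ji] := eqVneq j i; first by rewrite !deviate_same.
by rewrite !deviate_other // E.
Qed.

Lemma best_resp_unique U a i (x : 'I_(m i)) :
  (forall y, y != x -> (U i (deviate a y) < U i (deviate a x))%R) ->
  best_resp U a i = x.
Proof.
move=> H; apply/eqP/negPn/negP => /H; rewrite ltNge.
by rewrite best_resp_max.
Qed.

End BestResponse.

(** * Clockwork runs and prescribed sequences of actions *)

Section Play.
Variables (R : realType) (n : nat) (m : 'I_n -> nat).
Hypotheses (n_gt0 : 0 < n) (m_gt0 : forall i, 0 < m i).
Local Notation pl := (pl n_gt0).
Implicit Types (U : 'I_n -> profile m -> R) (a : profile m) (xi : nat -> nat).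

Definition valid xi := forall s, xi s < m (pl s).

Definition st xi t : profile m :=
  finfun (fun j : 'I_n => clip m_gt0 j (xi (pos t j))).

Lemma st_pl xi s t : valid xi -> t <= s < t + n -> st xi t (pl s) = xi s :> nat.
Proof.
by move=> V H; rewrite ffunE pos_pl // clipE // V.
Qed.

Lemma eq_st xi xi' t :
  (forall s, t <= s < t + n -> xi s = xi' s) -> st xi t = st xi' t.
Proof. by move=> E; apply/ffunP => j; rewrite !ffunE E // pos_window. Qed.

Lemma stP xi t a :
  (forall s, t <= s < t + n -> xi s = a (pl s) :> nat) -> st xi t = a.
Proof.
move=> E; apply/ffunP => j; apply/val_inj; rewrite /= ffunE.
by rewrite E ?pos_window // pl_pos clipE.
Qed.

Lemma st_coll xi t t' : valid xi -> t' < t -> t = t' %[mod n] ->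
  (forall j, j != pl t -> st xi t j = st xi t' j) -> coll n xi t t'.
Proof.
move=> V tt E H; apply/collP; split => // u un.
rewrite -(@st_pl xi (t + u) t) //; last by lia.
rewrite -(@st_pl xi (t' + u) t') //; last by lia.
have -> : pl (t' + u) = pl (t + u).
  by apply/eqP; rewrite pl_eq eqn_modDr E.
by rewrite H // pl_window //; lia.
Qed.

Lemma coll_st xi t t' j : coll n xi t t' -> j != pl t -> st xi t j = st xi t' j.
Proof.
move=> /collP[tt E H] jt; have W := pos_window n_gt0 t j.
have ne : pos t j != t by apply: contra jt => /eqP <-; rewrite pl_pos.
have Ej : pl (t' + (pos t j - t)) = j.
  rewrite -[RHS](pl_pos n_gt0 t); apply/eqP; rewrite pl_eq.
  by rewrite -{2}(subnKC (proj1 (andP W))) eqn_modDr -E.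
have Ep : pos t' j = t' + (pos t j - t) by rewrite -{1}Ej pos_pl //; lia.
by rewrite !ffunE Ep -H ?subnKC //; lia.
Qed.

Definition path U a s : nat :=
  if s < n then a (pl s) else clockwork U a (s - n).+1 (pl s).

Lemma clockworkS U a t j : clockwork U a t.+1 j =
  if j == pl t then best_resp U (clockwork U a t) j else clockwork U a t j.
Proof. by rewrite ffunE -val_eqE. Qed.

Lemma path_clockwork U a s t : t <= s < t + n ->
  path U a s = clockwork U a t (pl s) :> nat.
Proof.
elim: t => [|t IH] H; first by rewrite /path ifT //; lia.
have [->|ne] := eqVneq s (t + n).
  by rewrite /path ltnNge leq_addl /= addnK.
rewrite clockworkS ifN ?IH //; first by lia.
by rewrite pl_window //; lia.
Qed.

Lemma clockwork_path U a j s t : pl s = j -> t <= s < t + n ->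
  clockwork U a t j = path U a s :> nat.
Proof. by move=> <- /path_clockwork ->. Qed.

Lemma path_valid U a : valid (path U a).
Proof. by move=> s; rewrite /path; case: ifP. Qed.

Lemma st_path U a t : st (path U a) t = clockwork U a t.
Proof. by apply: stP => s; apply: path_clockwork. Qed.

Lemma path_move U a t :
  path U a (t + n) = best_resp U (clockwork U a t) (pl t) :> nat.
Proof.
rewrite (@path_clockwork _ _ _ t.+1); last by lia.
by rewrite plDn clockworkS eqxx.
Qed.

Lemma path_det U a : deterministic n (path U a).
Proof.
move=> t t' C; have /collP[_ E _] := C; rewrite !path_move.
have -> : pl t' = pl t by apply/eqP; rewrite pl_eq E.
congr nat_of_ord; apply: best_resp_env => j jt; rewrite -!st_path.
exact: coll_st C jt.
Qed.

(** An equilibrium freezes the profile, so every later query repeats after one round. *)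
Lemma converges_coll U a : clockwork_converges U a ->
  exists T, forall s, T <= s -> coll n (path U a) (s + n) s.
Proof.
case=> t [_ pne]; exists t => s ts.
have const k : clockwork U a (t + k) = clockwork U a t.
  elim: k => [|k IH]; first by rewrite addn0.
  rewrite addnS; apply/ffunP => j; rewrite clockworkS IH -pne.
  by case: ifP.
have tail p : t <= p -> path U a p = clockwork U a t (pl p) :> nat.
  move=> tp; rewrite (@path_clockwork _ _ _ p); last by lia.
  by have := const (p - t); rewrite subnKC // => ->.
apply/collP; split; [lia|by rewrite modnDr|move=> u un].
by rewrite !tail; [rewrite addnAC plDn|lia|lia].
Qed.

(** A repetition after one round makes the path [n]-periodic, so no later move changes the
    profile. *)
Lemma coll_converges U a t : 1 < n ->
  coll n (path U a) (t + n) t -> clockwork_converges U a.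
Proof.
move=> n1 C; exists t.+1; split => //.
have const k : clockwork U a (t.+1 + k) = clockwork U a t.+1.
  elim: k => [|k IH]; first by rewrite addn0.
  rewrite -IH addnS; apply/ffunP => j; have [->|ne] := eqVneq j (pl (t.+1 + k)).
    apply: ord_inj; rewrite (clockwork_path U a (plDn n_gt0 _)); last by lia.
    rewrite -(@path_clockwork _ _ (t.+1 + k)); last by lia.
    have := coll_periodic (u := k.+1) n1 (@path_det U a) C isT.
    by rewrite addnAC !addnS !addSn.
  by rewrite clockworkS (negbTE ne).
(* Player [i] moves at time [pos t.+1 i]; as this changes nothing, [i] already plays a best
   response. *)
move=> i; have /andP[W _] := pos_window n_gt0 t.+1 i.
have := clockworkS U a (pos t.+1 i) i; rewrite pl_pos eqxx.
by rewrite -{2}(subnKC W) const -[in LHS](subnKC W) -addnS const.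
Qed.

Definition follows U xi t :=
  forall s, s < t -> best_resp U (st xi s) (pl s) = xi (s + n) :> nat.

Lemma follows_path U xi t : valid xi -> follows U xi t ->
  forall s, s < t + n -> path U (st xi 0) s = xi s.
Proof.
move=> V; elim: t => [|t IH] H s st_.
  by rewrite (@path_clockwork _ _ _ 0) //= st_pl.
have IH' := IH (fun s st => H s (leqW st)).
have [->|ne] := eqVneq s (t + n); last by apply: IH'; lia.
rewrite path_move -st_path (eq_st (xi' := xi)) ?H // => r ?; apply: IH'; lia.
Qed.

Lemma path_follows U a t : follows U (path U a) t.
Proof. by move=> s _; rewrite st_path path_move. Qed.

Lemma eq_follows U xi xi' t : (forall s, s < t + n -> xi s = xi' s) ->
  follows U xi t -> follows U xi' t.
Proof.
move=> E H s st; rewrite -E; last by lia.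
by rewrite -H // (eq_st (xi' := xi)) // => r ?; rewrite E //; lia.
Qed.

Lemma follows_coll U xi t t' : coll n xi t t' -> xi (t + n) = xi (t' + n) ->
  follows U xi t -> follows U xi t.+1.
Proof.
move=> C E H s; rewrite ltnS leq_eqVlt => /predU1P[->|/H//].
have /collP[tt Em _] := C; rewrite E -H //.
have -> : pl t' = pl t by apply/eqP; rewrite pl_eq Em.
by congr nat_of_ord; apply: best_resp_env => j jt; apply: coll_st C jt.
Qed.

Definition payoffs (v : 'I_n * profile m -> R) : 'I_n -> profile m -> R :=
  fun i a => v (i, a).

(* Exchanging two payoffs of the block queried at time t does not affect the
   earlier queries of a path without repetition, but exchanges the best
   responses at time t. *)
Lemma follows_swap v xi t (x y : 'I_(m (pl t))) :
  valid xi -> (forall s, ~~ coll n xi t s) ->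
  let tau := tperm (pl t, deviate (st xi t) x) (pl t, deviate (st xi t) y) in
  follows (payoffs (v \o tau)) xi t <-> follows (payoffs v) xi t.
Proof.
move=> V F tau.
suff E s : s < t -> best_resp (payoffs (v \o tau)) (st xi s) (pl s)
                  = best_resp (payoffs v) (st xi s) (pl s).
  by split=> H s st; have := H s st; rewrite E.
move=> s_t; apply: eq_best_resp => z z'; rewrite /payoffs /=.
(* If the query at [s] looked up an exchanged payoff, the query at [t] would repeat it. *)
suff fix_ (w : 'I_(m (pl s))) (w' : 'I_(m (pl t))) :
    (pl t, deviate (st xi t) w') == (pl s, deviate (st xi s) w) = false.
  by rewrite !tpermD //; apply/negbT/fix_.
apply/negbTE/negP => /eqP[Ep Ed].
case/negP: (F s); apply: st_coll => //.
move=> j jt; rewrite -(deviate_other _ w' jt) Ed deviate_other //.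
by apply: contra jt => /eqP ->; apply/eqP/val_inj.
Qed.

(** Within the block the exchange relabels [x] and [y]; without ties the unique maximiser is
    relabelled with them. *)
Lemma best_resp_swap v a i (x y : 'I_(m i)) : injective v ->
  best_resp (payoffs (v \o tperm (i, deviate a x) (i, deviate a y))) a i = y <->
  best_resp (payoffs v) a i = x.
Proof.
move=> v_inj; set tau := tperm _ _; set w := tperm x y.
have tauE z : tau (i, deviate a z) = (i, deviate a (w z)).
  rewrite /w; case: tpermP => [->|->|/eqP zx /eqP zy].
  - by rewrite /tau tpermL.
  - by rewrite /tau tpermR.
  - by rewrite /tau tpermD // xpair_eqE eqxx /= (inj_eq (@deviate_inj _ _ _ _)) eq_sym.
have -> : best_resp (payoffs (v \o tau)) a i = w (best_resp (payoffs v) a i).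
  apply: best_resp_unique => z zw; rewrite /payoffs /= !tauE /w tpermK -/w.
  rewrite lt_neqAle; apply/andP; split; last exact: (best_resp_max (payoffs v)).
  rewrite (inj_eq v_inj) xpair_eqE eqxx /= (inj_eq (@deviate_inj _ _ _ _)).
  by apply: contra zw => /eqP <-; rewrite /w tpermK.
split=> [E|->]; last by rewrite /w tpermL.
by rewrite -[LHS](tpermK x y) -/w E /w tpermR.
Qed.

End Play.

Local Open Scope classical_set_scope.
Local Open Scope ring_scope.

(** * Exchangeability of the payoffs *)

Lemma fin_sum_fsbig (R : realType) (I : finType) (A : pred I) (f : I -> \bar R) :
  (\sum_(i \in [set i | A i]) f i = \sum_(i | A i) f i)%E.
Proof.
have -> : [set i | A i] = [set` enum A].
  by apply/seteqP; split => i /=; rewrite mem_enum.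
by rewrite -fsbig_seq ?enum_uniq // big_enum.
Qed.

Section FiniteUnion.
Context (d : measure_display) (T : measurableType d) (R : realType).
Variable mu : {measure set T -> \bar R}.

Lemma measure_le_fin_sum (I : finType) (A : pred I) (F : I -> set T) (S : set T) :
  measurable S -> (forall i, A i -> measurable (F i)) ->
  (forall w, S w -> exists2 i, A i & F i w) ->
  (mu S <= \sum_(i | A i) mu (F i))%E.
Proof.
move=> mS mF SF; rewrite -fin_sum_fsbig.
by apply: content_sub_fsum => //; exact: finite_finset.
Qed.

Lemma measure_ge_fin_sum (I : finType) (A : pred I) (F : I -> set T) (S : set T) :
  measurable S -> (forall i, A i -> measurable (F i)) ->
  (forall i w, A i -> F i w -> S w) ->
  (forall i j w, A i -> A j -> F i w -> F j w -> i = j) ->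
  (\sum_(i | A i) mu (F i) <= mu S)%E.
Proof.
move=> mS mF SF disj; rewrite -fin_sum_fsbig.
rewrite -measure_fin_bigcup //; last 2 first.
- exact: finite_finset.
- by move=> i j Ai Aj [w [Fi Fj]]; apply: disj Fi Fj.
rewrite le_measure ?inE //; last by move=> w [i Ai Fi]; apply: SF Fi.
by apply: fin_bigcup_measurable => //; exact: finite_finset.
Qed.

Lemma measurable_saturated (F : finType) (f : T -> F) (S : set T) :
  (forall c, measurable (f @^-1` [set c])) ->
  (forall w w', f w = f w' -> S w -> S w') -> measurable S.
Proof.
move=> mf sat; have -> : S = \bigcup_(c in f @` S) (f @^-1` [set c]).
  apply/seteqP; split => [w Sw|w [_ [w' Sw' <-]] /= E]; last exact: sat Sw'.
  by exists (f w) => //; exists w.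
by apply: fin_bigcup_measurable => //; exact: finite_finset.
Qed.

End FiniteUnion.

(** * The product sigma-algebra on payoff vectors *)

Section Rectangles.
Variables (R : realType) (K : finType).

Definition rectangles : set (set (K -> measurableTypeR R)) :=
  [set C | exists2 B : K -> set R, (forall k, measurable (B k)) &
           C = [set v | forall k, B k (v k)]].

Local Notation vector := (g_sigma_algebraType rectangles).

Lemma rectangles_setI : setI_closed rectangles.
Proof.
move=> _ _ [B mB ->] [B' mB' ->]; exists (fun k => B k `&` B' k).
  by move=> k; apply: measurableI.
apply/seteqP; split => [v [H H'] k|v H]; first by split.
by split => k; have [] := H k.
Qed.

Lemma measurable_coord (k : K) : measurable_fun setT (fun v : vector => v k : R).
Proof.
move=> _ Y mY; rewrite setTI; apply: sub_sigma_algebra.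
exists (fun l => if l == k then Y else setT) => [l|]; first by case: ifP.
apply/seteqP; split => [v /= Yv l|v /(_ k)]; last by rewrite eqxx.
by case: eqP => [->|].
Qed.

Lemma measurable_vector (d : measure_display) (T : measurableType d)
  (V : K -> T -> R) : (forall k, measurable_fun setT (V k)) ->
  measurable_fun setT (fun w => (fun k => V k w) : vector).
Proof.
move=> mV; apply: (@measurability _ _ T vector setT _ rectangles) => //.
move=> _ [_ [B mB ->] <-]; rewrite setTI.
have -> : (fun w k => V k w) @^-1` [set v | forall k, B k (v k)]
  = \bigcap_(k in [set: K]) (V k @^-1` B k).
  by apply/seteqP; split => [w H k _|w H k]; exact: H.
apply: fin_bigcap_measurable => [|k _]; first exact: finite_finset.
by rewrite -[X in measurable X]setTI; apply: mV.
Qed.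

Definition comparisons (v : K -> R) : {ffun K * K -> bool} :=
  [ffun p => (v p.1 <= v p.2)%R].

Lemma comparisonsP (v v' : K -> R) : comparisons v = comparisons v' ->
  forall k l, (v k <= v l)%R = (v' k <= v' l)%R.
Proof. by move=> E k l; have /ffunP/(_ (k, l)) := E; rewrite !ffunE. Qed.

(* All events of the game depend on the payoffs through their comparisons only,
   of which there are finitely many. *)
Lemma measurable_comparisons (S : set vector) :
  (forall v v', comparisons v = comparisons v' -> S v -> S v') -> measurable S.
Proof.
apply: (@measurable_saturated _ vector _ comparisons) => c.
have -> : comparisons @^-1` [set c] =
  \bigcap_(p in [set: K * K]) ((fun v : vector => (v p.1 <= v p.2)%R) @^-1` [set c p]).
  apply/seteqP; split => [v /= <- p _ /=|v H /=]; first by rewrite ffunE.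
  by apply/ffunP => p; rewrite ffunE; apply: H.
apply: fin_bigcap_measurable => [|p _]; first exact: finite_finset.
rewrite -[X in measurable X]setTI.
by apply: measurable_realfun.measurable_fun_ler => //; exact: measurable_coord.
Qed.

End Rectangles.

Notation vector R K := (g_sigma_algebraType (@rectangles R K)).

Section Exchangeable.
Context (R : realType) (d : measure_display) (T : measurableType d).
Variables (P : probability T R) (K : finType) (V : K -> T -> R) (D : set T).
Hypotheses (mV : forall k, measurable_fun setT (V k)) (mD : measurable D).
Hypothesis iidV : forall k l (B : set R), measurable B ->
  P (V k @^-1` B) = P (V l @^-1` B).
Hypothesis indepV : forall B : K -> set R, (forall k, measurable (B k)) ->
  P (D `&` \bigcap_k (V k @^-1` B k)) =
  (P D * \big[*%E/1%E]_k P (V k @^-1` B k))%E.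

(** The two push-forwards of [P] restricted to [D] agree on rectangles, a generating class closed
    under intersection, hence everywhere. *)
Lemma exchangeable (s : {perm K}) (S : set (vector R K)) : measurable S ->
  P (D `&` [set w | S (fun k => V k w)]) = P (D `&` [set w | S (fun k => V (s k) w)]).
Proof.
move=> mS.
pose f1 w : vector R K := fun k => V k w.
pose f2 w : vector R K := fun k => V (s k) w.
have mf1 : measurable_fun setT f1 by apply: measurable_vector.
have mf2 : measurable_fun setT f2 by apply: (@measurable_vector _ _ _ _ (fun k => V (s k))).
pose m1 : {measure set (vector R K) -> \bar R} :=
  measure_function_pushforward__canonical__measure_function_Measure (mrestr P mD) mf1.
pose m2 : {measure set (vector R K) -> \bar R} :=
  measure_function_pushforward__canonical__measure_function_Measure (mrestr P mD) mf2.
rewrite !(setIC D); change (m1 S = m2 S).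
have rectE (g : {perm K}) (B : K -> set R) : (forall k, measurable (B k)) ->
    P ([set w | forall k, B k (V (g k) w)] `&` D)
    = (P D * \big[*%E/1%E]_k P (V k @^-1` B k))%E.
  move=> mB; rewrite setIC.
  have -> : [set w | forall k, B k (V (g k) w)]
    = \bigcap_k (V k @^-1` B ((g^-1)%g k)).
    apply/seteqP; split => [w H k _ /=|w H k].
      by have := H ((g^-1)%g k); rewrite permKV.
    by have := H (g k) I; rewrite /= permK.
  rewrite indepV //; congr (_ * _)%E.
  rewrite (reindex_inj (@perm_inj _ g)) /=; apply: eq_bigr => k _.
  by rewrite permK; apply: iidV.
apply: (@measure_unique _ R (vector R K) (@rectangles R K) (fun=> setT) _ _ _ _ m1 m2) => //.
- exact: rectangles_setI.
- move=> _; exists (fun=> setT) => //.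
  by apply/seteqP; split.
- by rewrite bigcup_const //; exists 0%N.
- move=> _ [B mB ->]; rewrite /m1 /m2 /= /pushforward /mrestr /=.
  have := rectE 1%g B mB; rewrite (_ : [set w | _] = f1 @^-1` [set v | forall k, B k (v k)]).
    by move=> ->; rewrite -(rectE s B mB).
  by apply/seteqP; split => w H k; have := H k; rewrite /= perm1.
- move=> _; rewrite /m1 /= /pushforward /mrestr /=.
  by rewrite setTI (le_lt_trans (probability_le1 _ _)) // ltry.
Qed.

End Exchangeable.

(** By independence the joint law is a product measure, and the sections of the diagonal are single
    points, which are null. *)
Lemma independent_atomless_tie (R : realType) (d : measure_display)
  (T : measurableType d) (P : probability T R) (X Y : T -> R) :
  measurable_fun setT X -> measurable_fun setT Y ->
  (forall A B : set R, measurable A -> measurable B ->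
     P (X @^-1` A `&` Y @^-1` B) = (P (X @^-1` A) * P (Y @^-1` B))%E) ->
  (forall x, P (Y @^-1` [set x]) = 0%E) ->
  P [set w | X w = Y w] = 0%E.
Proof.
move=> mX mY indep atomless.
have mXY : measurable_fun setT (fun w => (X w, Y w)).
  exact/measurable_fun_pair.
pose X' : {mfun T >-> R} := mfun_Sub (mem_set mX).
pose Y' : {mfun T >-> R} := mfun_Sub (mem_set mY).
pose muX : probability R R := distribution P X'.
pose muY : probability R R := distribution P Y'.
pose muXY : {measure set (R * R) -> \bar R} :=
  measure_function_pushforward__canonical__measure_function_Measure P mXY.
pose diag := [set p : R * R | p.1 == p.2].
have mdiag : measurable diag.
  rewrite -[diag]setTI.
  exact: (measurable_realfun.measurable_fun_eqr measurable_fst measurable_snd) (measurableT) [set true] _.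
have -> : [set w | X w = Y w] = (fun w => (X w, Y w)) @^-1` diag.
  by apply/seteqP; split => w /= /eqP.
transitivity (muXY diag) => //.
rewrite -(@product_measure_unique _ _ _ _ _ muX muY muXY) //.
rewrite /product_measure1; apply: integral0_eq => x _ /=.
rewrite -(atomless x); congr (P _).
apply/seteqP; split => w /=; rewrite /xsection /= inE /diag /=.
  by move=> /eqP.
by move=> ->.
Qed.

Lemma measure_eq_off_null (d : measure_display) (T : measurableType d) (R : realType)
  (mu : {measure set T -> \bar R}) (A B N : set T) :
  measurable A -> measurable B -> measurable N -> mu N = 0%E ->
  (forall w, ~ N w -> (A w <-> B w)) -> mu A = mu B.
Proof.
move=> mA mB mN N0 AB; rewrite -(measureU0 mA mN N0) -(measureU0 mB mN N0).
congr (mu _); apply/seteqP; split => w; have [Nw|/AB ABw] := pselect (N w).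
- by right.
- by move=> [/ABw ?|?]; [left|right].
- by right.
- by move=> [/ABw ?|?]; [left|right].
Qed.

(** * The law of the path *)

Section Comparisons.
Variables (R : realType) (n : nat) (m : 'I_n -> nat).
Hypotheses (n_gt0 : (0 < n)%N) (m_gt0 : forall i, (0 < m i)%N).
Variables v v' : 'I_n * profile m -> R.
Hypothesis vv' : comparisons v = comparisons v'.

Lemma best_resp_comparisons a i : best_resp (payoffs v) a i = best_resp (payoffs v') a i.
Proof. by apply: eq_best_resp => x y; exact: (comparisonsP vv' (i, _) (i, _)). Qed.

Lemma clockwork_comparisons a t : clockwork (payoffs v) a t = clockwork (payoffs v') a t.
Proof.
elim: t => //= t ->; apply/ffunP => j; rewrite !ffunE.
by case: ifP => // _; apply: best_resp_comparisons.
Qed.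

Lemma converges_comparisons a :
  clockwork_converges (payoffs v) a -> clockwork_converges (payoffs v') a.
Proof.
case=> t [t0 H]; exists t; split => // i.
by rewrite -clockwork_comparisons -best_resp_comparisons -H.
Qed.

Lemma path_comparisons a : path n_gt0 (payoffs v) a = path n_gt0 (payoffs v') a.
Proof. by apply/funext => s; rewrite /path clockwork_comparisons. Qed.

Lemma follows_comparisons xi t :
  follows n_gt0 m_gt0 (payoffs v) xi t -> follows n_gt0 m_gt0 (payoffs v') xi t.
Proof. by move=> H s st; rewrite -best_resp_comparisons H. Qed.

End Comparisons.

Section Law.
Context (R : realType) (d : measure_display) (T : measurableType d).
Variables (P : probability T R) (n : nat) (m : 'I_n -> nat).
Variables (U : 'I_n -> profile m -> T -> R) (A0 : T -> profile m).
Hypotheses (n_gt0 : (0 < n)%N) (m_gt0 : forall i, (0 < m i)%N).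
Hypothesis mU : forall i a, measurable_fun setT (U i a).
Hypothesis iidU : forall i a j b (B : set R), measurable B ->
  P (U i a @^-1` B) = P (U j b @^-1` B).
Hypothesis atomlessU : forall i a (x : R), P (U i a @^-1` [set x]) = 0%E.
Hypothesis uniformA0 : forall a : profile m, measurable (A0 @^-1` [set a]) /\
  P (A0 @^-1` [set a]) = ((#|profile m|%:R)^-1)%:E.
Hypothesis indepU : forall (S : set (profile m)) (B : 'I_n * profile m -> set R),
  (forall k, measurable (B k)) ->
  P (A0 @^-1` S `&` \bigcap_k (U k.1 k.2 @^-1` B k)) =
  (P (A0 @^-1` S) * \big[*%E/1%E]_(k : 'I_n * profile m) P (U k.1 k.2 @^-1` B k))%E.

Local Notation K := ('I_n * profile m)%type.
Local Notation pl := (pl n_gt0).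
Local Notation st := (st m_gt0).
Local Notation follows := (follows n_gt0 m_gt0).
Local Notation moves := (@moves n m n_gt0).

Definition vec w : K -> R := fun k => U k.1 k.2 w.

Lemma measurable_event (S : profile m -> (K -> R) -> Prop) :
  (forall a v v', comparisons v = comparisons v' -> S a v -> S a v') ->
  measurable [set w | S (A0 w) (vec w)].
Proof.
move=> sat; apply: (@measurable_saturated _ _ _ (fun w => (A0 w, comparisons (vec w)))).
  move=> [a c].
  have -> : (fun w => (A0 w, comparisons (vec w))) @^-1` [set (a, c)]
     = A0 @^-1` [set a] `&` vec @^-1` [set v | comparisons v = c].
    by apply/seteqP; split => [w [<- <-]//|w [<- <-]].
  apply: measurableI; first by have [] := uniformA0 a.
  have mv : measurable_fun setT (vec : T -> vector R K).
    by apply: (@measurable_vector _ _ _ _ (fun k => U k.1 k.2)) => k; exact: mU.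
  rewrite -[X in measurable X]setTI; apply: mv => //.
  by apply: measurable_comparisons => v v' E /= <-.
by move=> w w' [Ea Ec]; rewrite /= Ea; apply: sat.
Qed.

Lemma probability_tie k l : k != l -> P [set w | vec w k = vec w l] = 0%E.
Proof.
move=> kl; apply: independent_atomless_tie; [exact: mU|exact: mU| |].
  move=> A B mA mB.
  have := indepU setT (B := fun j => if j == k then A else if j == l then B else setT).
  rewrite preimage_setT setTI probability_setT mul1e.
  rewrite (bigD1 k) //= (bigD1 l) 1?eq_sym //= eqxx eq_sym (negbTE kl) eqxx.
  rewrite big1 ?mule1; last first.
    move=> j /andP[jk jl]; rewrite (negbTE jk) (negbTE jl).
    by rewrite preimage_setT probability_setT.
  move=> <-; last by move=> j; case: ifP => // _; case: ifP.
  congr (P _); apply/seteqP; split => [w [Aw Bw] j _ /=|w H].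
    by case: eqP => [->|_] //; case: eqP => [->|_].
  split; first by have := H k I; rewrite /= eqxx.
  by have := H l I; rewrite /= eqxx eq_sym (negbTE kl).
by move=> x; apply: atomlessU.
Qed.

Definition ties := [set w | ~ injective (vec w)].

Lemma measurable_ties : measurable ties.
Proof.
apply: (@measurable_event (fun _ v => ~ injective v)) => _ v v' E vN vI.
apply: vN => k l kl; apply: vI; apply/eqP; rewrite eq_le.
by rewrite -!(comparisonsP E) kl lexx.
Qed.

Lemma probability_ties : P ties = 0%E.
Proof.
apply/eqP; rewrite -measure_le0.
have mE (p : K * K) : measurable [set w | vec w p.1 = vec w p.2].
  apply: (@measurable_event (fun _ v => v p.1 = v p.2)) => _ v v' E vE.
  by apply/eqP; rewrite eq_le -!(comparisonsP E) vE lexx.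
apply: le_trans (@measure_le_fin_sum _ _ _ P _ (fun p : K * K => p.1 != p.2)
   (fun p => [set w | vec w p.1 = vec w p.2]) _ measurable_ties _ _) _ => //.
  move=> w tie; apply: contrapT => H; apply: tie => k l kl.
  by apply: contrapT => /eqP ne; apply: H; exists (k, l).
by rewrite big1 // => p; apply: probability_tie.
Qed.

(** For a valid [xi], the cylinder event that the play agrees with [xi] on its first [t + n]
    entries. *)
Definition starts xi t := [set w | A0 w = st xi 0 /\ follows (payoffs (vec w)) xi t].

Lemma measurable_starts xi t : measurable (starts xi t).
Proof.
apply: (@measurable_event (fun a v => a = st xi 0 /\ follows (payoffs v) xi t)).
by move=> a v v' E [-> H]; split => //; apply: follows_comparisons H.
Qed.

(** The event splits by the best response at time [t]; exchanging two payoffs of the queried block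
    shows the pieces to be equally likely. *)
Lemma starts_fresh xi t : valid m n_gt0 xi -> (forall s, ~~ coll n xi t s) ->
  P (starts xi t) = ((m (pl t))%:R%:E * P (starts xi t.+1))%E.
Proof.
move=> V F; set i := pl t; set a := st xi t.
pose S (x : 'I_(m i)) (v : vector R K) :=
  follows (payoffs v) xi t /\ best_resp (payoffs v) a i = x.
pose D := A0 @^-1` [set st xi 0].
pose E (x : 'I_(m i)) := D `&` [set w | S x (vec w)].
have satS x v v' : comparisons v = comparisons v' -> S x v -> S x v'.
  move=> C [H <-]; split; first exact: follows_comparisons H.
  exact/esym/best_resp_comparisons.
have mE x : measurable (E x).
  apply: (@measurable_event (fun b v => b = st xi 0 /\ S x v)).
  by move=> b v v' C [-> H]; split => //; apply: satS H.
have exch x y : P (E x) = P (E y).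
  rewrite /E; pose tau := tperm (i, deviate a x) (i, deviate a y).
  rewrite (@exchangeable _ _ _ P _ (fun k : K => U k.1 k.2) D _ _ _ _ tau (S x)).
  (* Off the null set of ties, the exchange carries one piece exactly to the other. *)
  - apply: (measure_eq_off_null _ (mE y) measurable_ties probability_ties).
      apply: (@measurable_event (fun b v => b = st xi 0 /\ S x (v \o tau))).
      move=> b v v' C [-> H]; split => //; apply: satS H; apply/ffunP => -[k l].
      by rewrite !ffunE /=; apply: comparisonsP.
    move=> w /contrapT inj; rewrite /S /=.
    have Ef := @follows_swap _ _ _ _ m_gt0 (vec w) _ _ x y V F.
    have Eb := best_resp_swap a y x inj.
    rewrite tpermC in Eb.
    split => -[Dw [H1 H2]]; split => //; split.
    + exact/Ef.
    + exact/Eb.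
    + exact/Ef.
    + exact/Eb.
  - by move=> k; exact: mU.
  - by have [] := uniformA0 (st xi 0).
  - by move=> k l B mB; apply: iidU.
  - by move=> B mB; exact: (indepU [set st xi 0]).
  - by apply: measurable_comparisons => v v'; exact: satS.
pose x0 : 'I_(m i) := clip m_gt0 i (xi (t + n)%N).
have -> : starts xi t.+1 = E x0.
  have x0E : x0 = xi (t + n)%N :> nat by rewrite clipE // /i -(plDn n_gt0).
  apply/seteqP; split => [w [Dw H]|w [Dw [H Hx]]].
    split => //; split => [s st|]; first exact/H/leqW.
    by apply: ord_inj; rewrite x0E; exact: H.
  split => // s; rewrite ltnS leq_eqVlt => /predU1P[->|/H//].
  by rewrite -x0E -Hx.
have -> : P (starts xi t) = (\sum_(x : 'I_(m i)) P (E x))%E.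
  apply/eqP; rewrite eq_le; apply/andP; split.
    apply: measure_le_fin_sum => //; first exact: measurable_starts.
    by move=> w [Dw H]; exists (best_resp (payoffs (vec w)) a i) => //.
  apply: measure_ge_fin_sum => //; first exact: measurable_starts.
    by move=> x w _ [Dw [H _]].
  by move=> x y w _ _ [_ [_ <-]] [_ [_ <-]].
rewrite (eq_bigr (fun=> P (E x0))) => [|x _]; last exact: exch.
have /fineK <- : P (E x0) \is a fin_num by exact: fin_num_measure.
by rewrite sumEFin sumr_const card_ord -EFinM mulr_natl.
Qed.

Definition consistent xi t :=
  forall s s', (s < t)%N -> coll n xi s s' -> xi (s + n)%N = xi (s' + n)%N.

Lemma starts_coll xi t s : coll n xi t s -> xi (t + n)%N = xi (s + n)%N ->
  starts xi t.+1 = starts xi t.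
Proof.
move=> C E; apply/seteqP; split => w [Dw H]; split => //.
  by move=> r rt; apply/H/leqW.
exact: follows_coll C E H.
Qed.

Lemma starts0 xi : P (starts xi 0) = (#|moves n|%:R^-1)%:E.
Proof.
have -> : starts xi 0 = A0 @^-1` [set st xi 0].
  by apply/seteqP; split => [w [Dw _]|w Dw].
have [_ ->] := uniformA0 (st xi 0); congr (_%:R^-1)%:E.
rewrite card_moves // card_dffun_ord //.
by apply: eq_bigr => i _; rewrite pl_ord.
Qed.

Lemma card_movesS l : #|moves l.+1| = (#|moves l| * m (pl l))%N.
Proof. by rewrite !card_moves // big_ord_recr. Qed.

Lemma card_moves_gt0 l : (0 < #|moves l|)%N.
Proof. by rewrite card_moves // prodn_gt0. Qed.

Lemma probability_starts xi t : valid m n_gt0 xi -> fresh n xi t ->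
  P (starts xi t) = (#|moves (t + n)|%:R^-1)%:E.
Proof.
move=> V; elim: t => [|t IH] F; first exact: starts0.
have mt : ((m (pl t))%:R : R) != 0 by rewrite pnatr_eq0 -lt0n.
have := starts_fresh V (fun s => freshP _ _ _ F t s (ltnSn t)).
rewrite IH; last by apply/freshP => s s' st; apply: (freshP _ _ _ F); exact: leqW.
move=> E; rewrite addSn card_movesS plDn natrM invfM EFinM E.
by rewrite muleAC -EFinM mulfV // mul1e.
Qed.

(** A fresh query contributes the factor 1/m of its player; a repeated one, answered consistently,
    contributes 1, which is no less. *)
Lemma probability_starts_ge xi t : valid m n_gt0 xi -> consistent xi t ->
  ((#|moves (t + n)|%:R^-1)%:E <= P (starts xi t))%E.
Proof.
move=> V; elim: t => [|t IH] C; first by rewrite starts0.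
have IH' := IH (fun s s' st => C s s' (leqW st)).
have mt : (0 : R) < (m (pl t))%:R by rewrite ltr0n.
rewrite addSn card_movesS plDn natrM invfM EFinM.
have [[s sC]|nC] := pselect (exists s, coll n xi t s).
  rewrite (starts_coll sC (C t s (ltnSn t) sC)); apply: le_trans IH'.
  rewrite -EFinM lee_fin ler_piMr ?invr_ge0 ?ler0n // invf_le1 // ler1n.
  exact: m_gt0.
have F s : ~~ coll n xi t s by apply/negP => H; apply: nC; exists s.
by rewrite lee_pdivrMr // muleC -(starts_fresh V F).
Qed.

Definition restrict l (xi : nat -> nat) : moves l :=
  finfun (fun s : 'I_l => clip m_gt0 (pl s) (xi s)).

Lemma ext_restrict l xi s : valid m n_gt0 xi -> (s < l)%N -> ext (restrict l xi) s = xi s.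
Proof.
by move=> V sl; rewrite -[s]/(nat_of_ord (Ordinal sl)) extE ffunE clipE.
Qed.

Local Notation play w := (path n_gt0 (payoffs (vec w)) (A0 w)).

(** Each fresh sequence is played with probability exactly 1 over the number of sequences, so
    counting suffices. *)
Lemma probability_path_le (E : (nat -> nat) -> bool) t :
  (forall xi xi', (forall s, (s < t + n)%N -> xi s = xi' s) -> E xi = E xi') ->
  (forall xi, E xi -> fresh n xi t) ->
  (P [set w | E (play w)]
     <= (#|[set x : moves (t + n) | E (ext x)]%SET|%:R / #|moves (t + n)|%:R)%:E)%E.
Proof.
move=> eqE EF.
have -> : (#|[set x : moves (t + n) | E (ext x)]%SET|%:R / #|moves (t + n)|%:R)%:E
    = (\sum_(x : moves (t + n) | E (ext x)) P (starts (ext x) t))%E.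
  rewrite (eq_bigr (fun=> (#|moves (t + n)|%:R^-1)%:E)) => [|x Ex]; last first.
    by apply: probability_starts; [exact: ext_valid|exact: EF].
  by rewrite sumEFin big_const iter_addr_0 cardsE mulr_natl.
apply: measure_le_fin_sum.
- apply: (@measurable_event (fun a v => E (path n_gt0 (payoffs v) a))) => a v v' C.
  by rewrite (path_comparisons n_gt0 C).
- by move=> x _; exact: measurable_starts.
move=> w Ew; set x := restrict (t + n) (play w).
have xE s : (s < t + n)%N -> ext x s = play w s.
  by move=> sl; apply: ext_restrict => //; exact: path_valid.
exists x; first by rewrite (eqE _ (play w)).
split.
  rewrite (@eq_st _ _ _ _ _ (play w)) ?st_path // => s sn; apply: xE; lia.
apply: (@eq_follows _ _ _ _ _ _ (play w)) => [s sn|]; first by rewrite xE.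
exact: path_follows.
Qed.

Lemma starts_path t (x : moves (t + n)) w : starts (ext x) t w ->
  forall s, (s < t + n)%N -> play w s = ext x s.
Proof.
by move=> [-> H]; apply: follows_path => //; exact: ext_valid.
Qed.

(** The events of distinct sequences are disjoint, since each determines the play before [t + n]. *)
Lemma probability_starts_sum_ge t (A : {set moves (t + n)}) :
  (forall x, x \in A -> consistent (ext x) t) ->
  ((#|A|%:R / #|moves (t + n)|%:R)%:E
     <= P [set w | exists2 x, x \in A & starts (ext x) t w])%E.
Proof.
move=> AC.
have mF : measurable [set w | exists2 x, x \in A & starts (ext x) t w].
  apply: (@measurable_event (fun a v => exists2 x, x \in A &
     a = st (ext x) 0 /\ follows (payoffs v) (ext x) t)) => a v v' C [x xA [-> H]].
  by exists x => //; split => //; apply: follows_comparisons H.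
apply: (@le_trans _ _ (\sum_(x in A) P (starts (ext x) t))%E).
  have -> : (#|A|%:R / #|moves (t + n)|%:R : R) = \sum_(x in A) #|moves (t + n)|%:R^-1.
    by rewrite big_const iter_addr_0 mulr_natl.
  rewrite -sumEFin; apply: lee_sum => x xA; apply: probability_starts_ge; last exact: AC.
  exact: ext_valid.
apply: measure_ge_fin_sum => //.
- by move=> x _; exact: measurable_starts.
- by move=> x w xA Hw; exists x.
move=> x y w _ _ Hx Hy; apply: eq_ext => s sl.
by rewrite -(starts_path Hx) // (starts_path Hy).
Qed.

Lemma measurable_converges :
  measurable [set w | clockwork_converges (payoffs (vec w)) (A0 w)].
Proof.
apply: (@measurable_event (fun a v => clockwork_converges (payoffs v) a)).
by move=> a v v' C; apply: converges_comparisons.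
Qed.

Lemma converges_le (i : 'I_n) N : (1 < n)%N -> (forall j, others m i <= others m j)%N ->
  (P [set w | clockwork_converges (payoffs (vec w)) (A0 w)]
   <= ((others m i ^_ N.+1)%:R / (others m i ^ N.+1)%:R
       + (N * n)%:R / (others m i)%:R)%:E)%E.
Proof.
move=> n1 imin; set q := others m i.
have q0 : (0 < q)%N by exact: others_gt0.
set tau := (N * n + i)%N.
(* For [k < N * n], the first repetition is that of query [k] one round later; the last index stands
   for no repetition through the first [N + 1] queries of [i]. *)
pose E (k : nat) (xi : nat -> nat) : bool :=
  if (k < N * n)%N then fresh n xi (k + n) && coll n xi (k + n) k
  else fresh n xi tau.+1.
have mE k : measurable [set w | E k (play w)].
  apply: (@measurable_event (fun a v => E k (path n_gt0 (payoffs v) a))) => a v v' C.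
  by rewrite (path_comparisons n_gt0 C).
have le : (P [set w | clockwork_converges (payoffs (vec w)) (A0 w)]
   <= \sum_(k < (N * n).+1) P [set w | E k (play w)])%E.
  apply: measure_le_fin_sum => //; first exact: measurable_converges.
  move=> w conv; have [Tc evc] := converges_coll n_gt0 conv.
  have [F|nF] := boolP (fresh n (play w) tau.+1).
    by exists ord_max => //=; rewrite /E ltnn.
  have [t [t_tau [t' C] tmin]] : exists t, [/\ (t <= tau)%N, exists t', coll n (play w) t t'
      & fresh n (play w) t].
    have ex : exists t, ~~ fresh n (play w) t.+1 by exists tau.
    case: (ex_minnP ex) => t nFt tmin.
    have Ft : fresh n (play w) t.
      case: t nFt tmin => [_ _|t _ tmin]; first by apply/freshP.
      by apply/negPn/negP => /tmin; rewrite ltnn.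
    exists t; split => //; first exact: tmin.
    apply: contrapT => nex; case/negP: nFt; apply/freshP => s s'.
    rewrite ltnS leq_eqVlt => /predU1P[->|st]; last exact: (freshP _ _ _ Ft).
    by apply/negP => C; apply: nex; exists s'.
  have Et := first_coll_gap n1 (@path_det _ _ _ _ m_gt0 _ _) tmin C evc.
  (* Here [t' + n <= N * n + i < (N + 1) * n]. *)
  have t'N : (t' < N * n)%N by have := ltn_ord i; rewrite /tau in t_tau; lia.
  exists (Ordinal (ltnW t'N : t' < (N * n).+1)%N) => //=.
  by rewrite /E t'N -Et tmin C.
apply: le_trans le _; rewrite big_ord_recr /= addrC EFinD; apply: leeD.
  rewrite /E ltnn; apply: le_trans (@probability_path_le (fun xi => fresh n xi tau.+1) tau _ _) _.
  - by move=> xi xi' H; apply: eq_fresh => s; rewrite addSn ltnS; apply: H.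
  - by move=> xi /freshP F; apply/freshP => s s' st; apply: F; exact: leqW.
  rewrite lee_fin ler_pdivrMr ?ltr0n ?card_moves_gt0 // mulrAC ler_pdivlMr ?ltr0n ?expn_gt0 ?q0 //.
  by rewrite -!natrM ler_nat; apply: birthday.
apply: (@le_trans _ _ (\sum_(k < N * n) (q%:R^-1)%:E)%E).
  apply: lee_sum => k _; rewrite /E ltn_ord.
  apply: le_trans (@probability_path_le (fun xi => fresh n xi (k + n) && coll n xi (k + n) k) (k + n) _ _) _.
  - move=> xi xi' H; rewrite (eq_coll _ H) (@eq_fresh _ xi xi') // => s sn.
    by apply: H; exact: ltnW.
  - by move=> xi /andP[].
  rewrite lee_fin ler_pdivrMr ?ltr0n ?card_moves_gt0 // ler_pdivlMl ?ltr0n //.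
  rewrite -natrM ler_nat.
  apply: leq_trans (@card_coll_le n m n_gt0 m_gt0 (k + n + n) (k + n) k _ _); last 2 first.
  - by [].
  - by rewrite -[ltnLHS]addn0 ltn_add2l.
  rewrite mulnC leq_mul ?imin //; apply/subset_leq_card/fintype.subsetP => x.
  by rewrite !inE => /andP[].
by rewrite sumEFin sumr_const card_ord mulr_natl.
Qed.

Lemma eq_bad xi xi' t : (forall s, (s < t + n + n)%N -> xi s = xi' s) ->
  bad n xi t = bad n xi' t.
Proof.
move=> H; apply/badP/badP => -[s [s' [st C B]]]; exists s, s'; split => //.
  by rewrite -(@eq_coll _ xi) // => r ?; apply: H; lia.
by rewrite (@eq_coll _ xi xi') // => r ?; apply: H; lia.
Qed.

Lemma converges_ge (i : 'I_n) N : (1 < n)%N -> (forall j, others m i <= others m j)%N ->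
  ((\sum_(k < N) ((others m i)%:R^-1
     - (n * (k * (k + 3)))%:R / 2 / (others m i)%:R ^+ 2))%:E
   <= P [set w | clockwork_converges (payoffs (vec w)) (A0 w)])%E.
Proof.
move=> n1 imin; set q := others m i.
have q0 : (0 : R) < q%:R by rewrite ltr0n others_gt0.
pose t k := (k * n + i)%N.
have plt k : pl (t k) = i by rewrite /t addnC plDM pl_ord.
pose F (k : nat) := [set w | exists2 x, x \in good_hits m n_gt0 (t k) &
   starts (ext x) (t k + n) w].
have FP k w : F k w -> coll n (play w) (t k + n) (t k) && ~~ bad n (play w) (t k).
  move=> [x]; rewrite !inE => H /starts_path E.
  by rewrite (@eq_bad _ (ext x)) // (@eq_coll _ _ (ext x)).
apply: (@le_trans _ _ (\sum_(k < N) P (F k))%E); last first.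
  apply: measure_ge_fin_sum => //.
  - exact: measurable_converges.
  - move=> k _.
    apply: (@measurable_event (fun a v => exists2 x, x \in good_hits m n_gt0 (t k) &
     a = st (ext x) 0 /\ follows (payoffs v) (ext x) (t k + n))) => a v v' C [x xA [-> H]].
    by exists x => //; split => //; apply: follows_comparisons H.
  - by move=> k w _ /FP/andP[C _]; apply: coll_converges C.
  suff disj (k l : 'I_N) w : (k < l)%N -> F k w -> F l w -> False.
    move=> k l w _ _ Fk Fl; apply/val_inj/eqP; case: ltngtP => // kl.
      by case: (disj _ _ _ kl Fk Fl).
    by case: (disj _ _ _ kl Fl Fk).
  (* A hit in round [k] is a bad repetition for every later round [l], so the events are
     disjoint. *)
  move=> kl /FP/andP[C _] /FP/andP[_ /badP]; apply; exists (t k + n)%N, (t k).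
  have le : (t k + n <= t l)%N by rewrite /t; nia.
  by split => //; [lia|rewrite le].
rewrite -sumEFin; apply: lee_sum => k _.
apply: le_trans (@probability_starts_sum_ge (t k + n) (good_hits m n_gt0 (t k)) _); last first.
  by move=> x xg s s' st C; apply: good_hits_consistent xg st C.
have := @card_good_hits _ m n_gt0 m_gt0 (t k); rewrite plt => /(_ imin).
have := sum_bad_count n_gt0 i k; rewrite -/(t k).
set c := (\sum_(s < _) _)%N; set X := #|moves _|; set g := #|good_hits _ _ _| => Hc Hg.
have X0 : (0 : R) < X%:R by rewrite ltr0n /X card_moves_gt0.
have Hc' : c%:R <= (n * (k * (k + 3)))%:R / 2 :> R.
  by rewrite ler_pdivlMr // -natrM ler_nat muln2.
have Hg' : q%:R * X%:R <= q%:R ^+ 2 * g%:R + c%:R * X%:R :> R.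
  by rewrite -natrX -!natrM -natrD ler_nat.
rewrite lee_fin ler_pdivlMr //.
apply: (@le_trans _ _ ((q%:R^-1 - c%:R / q%:R ^+ 2) * X%:R)).
  by rewrite ler_pM2r // lerD2l lerN2 ler_pM2r // invr_gt0 exprn_gt0.
rewrite -(@ler_pM2l _ (q%:R ^+ 2)) ?exprn_gt0 //.
have -> : q%:R ^+ 2 * ((q%:R^-1 - c%:R / q%:R ^+ 2) * X%:R) = q%:R * X%:R - c%:R * X%:R :> R.
  by field; rewrite gt_eqF.
by rewrite lerBlDr.
Qed.

End Law.

(** * Numerical estimates *)

Section Estimates.
Variable R : realType.

Lemma ffact_le_expR (q N : nat) : (0 < q)%N ->
  (q ^_ N)%:R / (q ^ N)%:R <= expR (- (N%:R * (N%:R - 1) / 2 / q%:R)) :> R.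
Proof.
move=> q0; have q0' : (0 : R) < q%:R by rewrite ltr0n.
elim: N => [|N IH]; first by rewrite !mul0r oppr0 expR0 divr1.
rewrite ffactnSr expnSr !natrM invfM mulrACA.
have -> : - (N.+1%:R * (N.+1%:R - 1) / 2 / q%:R)
    = - (N%:R * (N%:R - 1) / 2 / q%:R) + - (N%:R / q%:R) :> R.
  by rewrite -natr1; field; rewrite gt_eqF.
rewrite expRD; apply: ler_pM => //; try by rewrite mulr_ge0 ?invr_ge0 ?ler0n.
(* The new factor is [1 - N / q], at most [exp (- N / q)]; for [q <= N] truncated subtraction makes
   it 0. *)
have [qN|Nq] := leqP q N.
  by rewrite (eqP qN) mul0r expR_ge0.
apply: le_trans (expR_ge1Dx _).
by rewrite natrB ?(ltnW Nq) // mulrBl divff ?gt_eqF.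
Qed.

Lemma ln2_ge_half : 2^-1 <= ln (2 : R).
Proof.
rewrite -[leLHS]expRK ler_ln ?posrE ?expR_gt0 //.
have := expR_ge1Dx (- 2^-1 : R); rewrite expRN => H.
have e0 := expR_gt0 (2^-1 : R).
have : 2^-1 <= (expR (2^-1 : R))^-1 by apply: le_trans H; lra.
by rewrite lef_pV2 ?posrE.
Qed.

Lemma upper_estimate (n q : nat) (p : R) : (2 <= n)%N -> (2 <= q)%N ->
  (forall N, p <= (q ^_ N.+1)%:R / (q ^ N.+1)%:R + (N * n)%:R / q%:R) ->
  p <= 6 * n%:R * Num.sqrt (ln q%:R) / Num.sqrt q%:R.
Proof.
move=> n2 q2 H.
have q0 : (0 : R) < q%:R by rewrite ltr0n ltnW.
have q2' : (2 : R) <= q%:R by rewrite ler_nat.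
have n2' : (2 : R) <= n%:R by rewrite ler_nat.
have lnq : 2^-1 <= ln (q%:R : R).
  by apply: le_trans ln2_ge_half _; rewrite ler_ln ?posrE.
set s : R := Num.sqrt q%:R; set L : R := Num.sqrt (ln q%:R).
have s2 : s ^+ 2 = q%:R by rewrite sqr_sqrtr // ltW.
have L2 : L ^+ 2 = ln q%:R by rewrite sqr_sqrtr //; lra.
have s0 : 0 < s by rewrite sqrtr_gt0.
have L0 : 0 <= L by exact: sqrtr_ge0.
have s1 : 1 <= s.
  by rewrite -(ler_pXn2r (n := 2)) ?nnegrE ?(ltW s0) // s2; lra.
have Lh : 2^-1 <= L.
  by rewrite -(ler_pXn2r (n := 2)) ?nnegrE // L2; lra.
(* Rounding [sqrt (q * ln q)] up to [N] makes the exponent at least [ln q / 2], so the birthday term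
   is at most [1 / sqrt q]. *)
pose x : R := s * L; have x0 : 0 <= x by rewrite mulr_ge0 // ltW.
have [N [xN Nx]] : exists N : nat, x <= N%:R /\ N%:R <= x + 1.
  have /andP[Nx xN] := truncn_itv x0; exists (Num.truncn x).+1.
  by rewrite (ltW xN) -natr1 lerD2r.
have E1 : (q ^_ N.+1)%:R / (q ^ N.+1)%:R <= s^-1.
  have q_gt0 := ltnW q2.
  apply: le_trans (ffact_le_expR N.+1 q_gt0) _.
  have -> : s^-1 = expR (- (ln q%:R / 2)).
    rewrite expRN; congr (_^-1); rewrite /s -[in LHS](@lnK _ (q%:R : R)) ?posrE //.
    have -> : ln (q%:R : R) = ln q%:R / 2 + ln q%:R / 2 by field.
    by rewrite expRD -expr2 sqrtr_sqr ger0_norm ?expR_ge0 //; congr expR; field.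
  rewrite ler_expR lerN2 -L2 -(@natr1 R N) addrK ler_pdivlMr //.
  have -> : L ^+ 2 / 2 * q%:R = x ^+ 2 / 2 by rewrite -s2 /x exprMn mulrC mulrA.
  rewrite ler_pM2r ?invr_gt0 // expr2.
  apply: (@le_trans _ _ (N%:R * N%:R)); first by apply: ler_pM.
  by rewrite ler_wpM2r ?lerDl ?ler0n.
apply: le_trans (H N) _.
set u := s^-1; have u0 : 0 < u by rewrite invr_gt0.
have u1 : u <= 1 by rewrite invf_le1.
have E2 : (N * n)%:R / q%:R <= (n%:R * L + n%:R * u) * u.
  rewrite natrM -s2 expr2 invfM mulrA ler_pM2r // -/u.
  have -> : n%:R * L + n%:R * u = (x + 1) * n%:R * u.
    have su : s * u = 1 by rewrite mulfV // gt_eqF.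
    transitivity (s * u * (n%:R * L) + n%:R * u); first by rewrite su mul1r.
    by rewrite /x; ring.
  by rewrite !ler_pM2r // ltr0n ltnW.
apply: le_trans (lerD E1 E2) _.
rewrite -[X in X + _]mul1r -mulrDl ler_pM2r //.
(* As [n >= 2] and [L >= 1/2], both [1 <= n L] and [n <= 2 n L], so [1 + n L + n u] is at most
   [4 n L]. *)
have nu : n%:R * u <= n%:R by rewrite ler_piMr.
have nL : n%:R * 2^-1 <= n%:R * L by rewrite ler_pM2l // ltr0n ltnW.
by rewrite -(mulrA 6); lra.
Qed.

(** Since [n N^2 <= q], the subtracted terms take at most half of [N / q]; since
    [sqrt (q / n) >= 1], rounding down loses at most another factor 2. *)
Lemma lower_estimate (n q N : nat) : (0 < n)%N -> (n <= q)%N ->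
  N = Num.truncn (Num.sqrt (q%:R / n%:R : R)) ->
  (4 * Num.sqrt n%:R)^-1 * (Num.sqrt q%:R)^-1
    <= \sum_(k < N) (q%:R^-1 - (n * (k * (k + 3)))%:R / 2 / q%:R ^+ 2) :> R.
Proof.
move=> n0 nq NE.
have q0 : (0 : R) < q%:R by rewrite ltr0n (leq_trans n0).
have n0' : (0 : R) < n%:R by rewrite ltr0n.
set r : R := Num.sqrt n%:R; set s : R := Num.sqrt q%:R.
have s2 : s ^+ 2 = q%:R by rewrite sqr_sqrtr // ltW.
have r2 : r ^+ 2 = n%:R by rewrite sqr_sqrtr // ltW.
have s0 : 0 < s by rewrite sqrtr_gt0.
have r0 : 0 < r by rewrite sqrtr_gt0.
have xE : Num.sqrt (q%:R / n%:R : R) = s / r by rewrite sqrtrM ?ler0n // sqrtrV ?ler0n.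
have x1 : 1 <= s / r by rewrite ler_pdivlMr // mul1r ler_sqrt // ler_nat.
have x0 : 0 <= s / r by lra.
have /andP[Nx xN] := truncn_itv x0; rewrite -xE -NE xE in Nx xN.
have N1 : (1 : R) <= N%:R.
  by rewrite ler1n lt0n; apply/eqP => N0; move: xN; rewrite N0 ltNge x1.
have cube K : (\sum_(k < K) k * (k + 3) <= K ^ 3)%N.
  elim: K => [|K IH]; first by rewrite big_ord0.
  rewrite big_ord_recr /=; apply: (@leq_trans (K ^ 3 + K * (K + 3))); first by rewrite leq_add2r.
  by rewrite !expnS !expn0 !muln1; nia.
have -> : \sum_(k < N) (q%:R^-1 - (n * (k * (k + 3)))%:R / 2 / q%:R ^+ 2)
   = N%:R / q%:R - n%:R * (\sum_(k < N) k * (k + 3))%N%:R / 2 / q%:R ^+ 2 :> R.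
  rewrite sumrB sumr_const card_ord -(mulr_natl q%:R^-1 N); congr (_ - _).
  rewrite natr_sum mulr_sumr !mulr_suml; apply: eq_bigr => k _.
  by rewrite natrM.
apply: (@le_trans _ _ (N%:R / q%:R - n%:R * N%:R ^+ 3 / 2 / q%:R ^+ 2)); last first.
  rewrite lerD2l lerN2 !ler_pM2r ?invr_gt0 ?exprn_gt0 // ler_pM2l //.
  by rewrite -natrX ler_nat.
have nN : n%:R * N%:R ^+ 2 <= q%:R :> R.
  rewrite -r2 -s2 -exprMn ler_pXn2r ?nnegrE ?(ltW s0) ?mulr_ge0 ?(ltW r0) ?ler0n //.
  by rewrite mulrC -ler_pdivlMr.
apply: (@le_trans _ _ (N%:R / (2 * q%:R))).
  rewrite invfM -mulrA -invfM ler_pdivlMr ?mulr_gt0 //.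
  have -> : 4^-1 * (r * s)^-1 * (2 * q%:R) = (s / r) / 2.
    by rewrite -s2; field; rewrite !gt_eqF.
  by rewrite ler_pdivrMr //; move: xN; rewrite -natr1; lra.
have -> : N%:R / q%:R - n%:R * N%:R ^+ 3 / 2 / q%:R ^+ 2
  = N%:R / (2 * q%:R) + N%:R / (2 * q%:R ^+ 2) * (q%:R - n%:R * N%:R ^+ 2) :> R.
  by field; rewrite gt_eqF.
rewrite lerDl mulr_ge0 ?subr_ge0 // divr_ge0 // mulr_ge0 // exprn_ge0 // ltW //.
Qed.

End Estimates.

(** * Both bounds, applied to a player with most actions *)

Theorem theorem2 (R : realType) (d : measure_display) (T : measurableType d)
  (P : probability T R) (n : nat) (m : 'I_n -> nat)
  (U : 'I_n -> profile m -> T -> R) (A0 : T -> profile m) :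
  (2 <= n)%N ->
  (forall i, (2 <= m i)%N) ->
  (* payoffs are real random variables *)
  (forall i a, measurable_fun setT (U i a)) ->
  (* identically distributed *)
  (forall i a j b (B : set R), measurable B ->
     P (U i a @^-1` B) = P (U j b @^-1` B)) ->
  (* the common distribution is atomless *)
  (forall i a (x : R), P (U i a @^-1` [set x]) = 0%E) ->
  (* A0 is uniform on the profiles *)
  (forall a : profile m, measurable (A0 @^-1` [set a]) /\
     P (A0 @^-1` [set a]) = ((#|profile m|%:R)^-1)%:E) ->
  (* the payoffs U_i(a) and A0 are mutually independent *)
  (forall (S : set (profile m)) (B : 'I_n * profile m -> set R),
     (forall k, measurable (B k)) ->
     P (A0 @^-1` S `&` \bigcap_k (U k.1 k.2 @^-1` B k)) =
     (P (A0 @^-1` S) * \big[*%E/1%E]_(k : 'I_n * profile m)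
                          P (U k.1 k.2 @^-1` B k))%E) ->
  let q := qnm R m in
  let p := P [set w | clockwork_converges (fun i a => U i a w) (A0 w)] in
  (((4 * Num.sqrt n%:R)^-1 * (Num.sqrt q)^-1)%:E <= p)%E /\
  (p <= (6 * n%:R * Num.sqrt (ln q) / Num.sqrt q)%:E)%E.
Proof.
move=> n2 m2 mU iidU atomU unifA indep q p.
have n_gt0 : (0 < n)%N := ltnW n2.
have m_gt0 i : (0 < m i)%N := ltnW (m2 i).
have [i imax] : {i : 'I_n | \max_(j < n) m j = m i}%N.
  by apply: bigop.eq_bigmax; rewrite card_ord.
have prodE j : (\prod_(k < n) m k = m j * others m j)%N by rewrite (bigD1 j).
(* All products [m j * others m j] agree, so a player with most actions faces the fewest queries. *)
have imin j : (others m i <= others m j)%N.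
  rewrite -(leq_pmul2l (m_gt0 i)) -prodE (prodE j) leq_mul2r -imax.
  by rewrite leq_bigmax orbT.
have qE : q = (others m i)%:R.
  by rewrite /q /qnm imax (prodE i) natrM mulrAC divff ?mul1r // pnatr_eq0 -lt0n.
(* This follows from [n <= 2 ^ (n - 1)], and it also yields [q >= 2] for the upper estimate. *)
have nq : (n <= others m i)%N.
  apply: (@leq_trans (\prod_(j < n | j != i) 2)%N); last exact: leq_prod.
  rewrite prod_nat_const cardC1 card_ord; apply: leq_trans (ltn_expl _ (ltnSn 1)).
  by rewrite prednK.
split; rewrite qE.
  apply: le_trans (@converges_ge R d T P n m U A0 n_gt0 m_gt0 mU iidU atomU unifA indep
    i (Num.truncn (Num.sqrt ((others m i)%:R / n%:R : R))) n2 imin).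
  by rewrite lee_fin; apply: lower_estimate.
have pfin : p \is a fin_num by apply: fin_num_measure; exact: (measurable_converges mU unifA).
rewrite -(fineK pfin) lee_fin; apply: upper_estimate => // [|N].
  exact: leq_trans nq.
rewrite -lee_fin (fineK pfin).
exact: (@converges_le R d T P n m U A0 n_gt0 m_gt0 mU iidU atomU unifA indep i N n2 imin).
Qed.
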